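(* Let $d\geq 2$ be an integer with $p\nmid d$. Then every $d$-Mahler function $f(z)\in\mathbb{K}\{z\}$ over $\mathbb{K}(z)$ is either transcendental over $\mathbb{K}(z)$ or belongs to $\mathbb{K}(z)$.
   Context: Let $p$ be a prime, $q=p^{r}$, $K=\mathbb{F}_{q}(T)$ with the $\frac1T$-adic absolute value, $C$ the completion of an algebraic closure of $\mathbb{F}_{q}((1/T))$, $\mathbb{K}$ a finite extension of $K$, and $\mathbb{K}\{z\}$ the power series with coefficients in $\mathbb{K}$ converging in a neighbourhood of $0$ in $C$. $f(z)$ is $d$-Mahler over $\mathbb{K}(z)$ if there exist $P_0,\ldots,P_n\in\mathbb{K}[z]$, $P_n\neq 0$, with $\sum_{i=0}^{n}P_i(z)f(z^{d^i})=0$. *)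

(* Defs.v *)
From HB Require Import structures.
From mathcomp Require Import all_boot all_order all_algebra all_field.
From mathcomp Require Import boolp classical_sets reals topology normedtype
  sequences.

Set Implicit Arguments.
Unset Strict Implicit.
Unset Printing Implicit Defensive.

Import Order.TTheory GRing.Theory Num.Theory.
Import numFieldNormedType.Exports.

Local Open Scope ring_scope.

Notation "x %:F" := (@FracField.tofrac _ x) : ring_scope.

Section Powser.
Variable F : fieldType.

(* pcoef f n is the coefficient of z^n *)
Record powser := Powser { pcoef :> nat -> F }.

HB.instance Definition _ := gen_eqMixin powser.
HB.instance Definition _ := gen_choiceMixin powser.

Lemma powserP (f g : powser) : f =1 g -> f = g.
Proof. by case: f g => [f] [g] /= /funext ->. Qed.

Definition powser_add (f g : powser) := Powser (fun n => f n + g n).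
Definition powser_opp (f : powser) := Powser (fun n => - f n).
Definition powser_zero := Powser (fun=> 0).
Definition powser_mul (f g : powser) :=
  Powser (fun n => \sum_(i < n.+1) f i * g (n - i)%N).
Definition powser_one := Powser (fun n => (n == 0)%:R).

Let powser_addA : associative powser_add.
Proof. by move=> f g h; apply: powserP => n /=; rewrite addrA. Qed.
Let powser_addC : commutative powser_add.
Proof. by move=> f g; apply: powserP => n /=; rewrite addrC. Qed.
Let powser_add0 : left_id powser_zero powser_add.
Proof. by move=> f; apply: powserP => n /=; rewrite add0r. Qed.
Let powser_addN : left_inverse powser_zero powser_opp powser_add.
Proof. by move=> f; apply: powserP => n /=; rewrite addNr. Qed.

HB.instance Definition _ := GRing.isZmodule.Build powser
  powser_addA powser_addC powser_add0 powser_addN.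

Definition powser_trunc N (f : powser) : {poly F} := \poly_(i < N) f i.

Let coef_trunc N f i : (i < N)%N -> (powser_trunc N f)`_i = f i.
Proof. by move=> ltiN; rewrite coef_poly ltiN. Qed.

Let coef_mul_trunc N (f g : powser) (p q : {poly F}) n : (n < N)%N ->
  (forall i, (i < N)%N -> p`_i = f i) -> (forall i, (i < N)%N -> q`_i = g i) ->
  (p * q)`_n = powser_mul f g n.
Proof.
move=> ltnN pf qg; rewrite coefM /=; apply: eq_bigr => i _.
by rewrite pf ?qg // (leq_ltn_trans _ ltnN) // ?leq_subr // -ltnS.
Qed.

Let powser_mulA : associative powser_mul.
Proof.
move=> f g h; apply: powserP => n.
pose t := powser_trunc n.+1.
have tE k : forall i, (i < n.+1)%N -> (t k)`_i = k i by exact: coef_trunc.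
have mE k l : forall i, (i < n.+1)%N -> (t k * t l)`_i = powser_mul k l i.
  by move=> i lti; apply: (coef_mul_trunc lti); apply: tE.
rewrite -(coef_mul_trunc (ltnSn n) (tE f) (mE g h)).
by rewrite -(coef_mul_trunc (ltnSn n) (mE f g) (tE h)) mulrA.
Qed.

Let powser_mulC : commutative powser_mul.
Proof.
move=> f g; apply: powserP => n.
pose t := powser_trunc n.+1.
have tE k : forall i, (i < n.+1)%N -> (t k)`_i = k i by exact: coef_trunc.
rewrite -(coef_mul_trunc (ltnSn n) (tE f) (tE g)).
by rewrite -(coef_mul_trunc (ltnSn n) (tE g) (tE f)) mulrC.
Qed.

Let powser_mul1 : left_id powser_one powser_mul.
Proof.
move=> f; apply: powserP => n /=.
rewrite big_ord_recl /= mul1r subn0 big1 ?addr0 // => i _.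
by rewrite mul0r.
Qed.

Let powser_mulDl : left_distributive powser_mul powser_add.
Proof.
move=> f g h; apply: powserP => n /=.
by rewrite -big_split; apply: eq_bigr => i _; rewrite mulrDl.
Qed.

Let powser_oner_neq0 : powser_one != 0 :> powser.
Proof.
by apply/eqP => /(congr1 (fun f : powser => f 0%N)) /eqP; rewrite oner_eq0.
Qed.

HB.instance Definition _ := GRing.Zmodule_isComNzRing.Build powser
  powser_mulA powser_mulC powser_mul1 powser_mulDl powser_oner_neq0.

Lemma pcoefD (f g : powser) n : (f + g) n = f n + g n. Proof. by []. Qed.
Lemma pcoefN (f : powser) n : (- f) n = - f n. Proof. by []. Qed.
Lemma pcoef0 n : (0 : powser) n = 0. Proof. by []. Qed.
Lemma pcoef1 n : (1 : powser) n = (n == 0)%:R. Proof. by []. Qed.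
Lemma pcoefM (f g : powser) n :
  (f * g) n = \sum_(i < n.+1) f i * g (n - i)%N.
Proof. by []. Qed.

Lemma powser_neq0P (f : powser) : f != 0 -> exists n, f n != 0.
Proof.
move=> f0; apply: contrapT => f0'; case/eqP: f0; apply: powserP => n.
by apply/eqP; apply: contrapT => /negP fn; apply: f0'; exists n.
Qed.

(* the order of vanishing at 0; the value for f = 0 is a dummy one *)
Definition ord (f : powser) : nat :=
  if pselect (exists n, f n != 0) is left h then ex_minn h else 0%N.

Lemma ordP (f : powser) n :
  f n != 0 -> (forall i, (i < n)%N -> f i = 0) -> ord f = n.
Proof.
move=> fn f_lt; rewrite /ord; case: pselect => [h|[]]; last by exists n.
case: ex_minnP => m fm min_m; apply/eqP; rewrite eqn_leq min_m // leqNgt.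
by apply/negP => /f_lt fm0; rewrite fm0 eqxx in fm.
Qed.

Lemma pcoef_ord (f : powser) : f != 0 -> f (ord f) != 0.
Proof.
move=> /powser_neq0P h; rewrite /ord; case: pselect => // h'.
by case: ex_minnP.
Qed.

Lemma pcoef_lt_ord (f : powser) i : (i < ord f)%N -> f i = 0.
Proof.
rewrite /ord; case: pselect => // h; case: ex_minnP => m fm min_m ltim.
by apply/eqP; apply: contraLR ltim => fi; rewrite -leqNgt min_m.
Qed.

Lemma pcoefM_ord (f g : powser) :
  (f * g) (ord f + ord g)%N = f (ord f) * g (ord g).
Proof.
have lt_f : (ord f < (ord f + ord g).+1)%N by rewrite ltnS leq_addr.
rewrite pcoefM (bigD1 (Ordinal lt_f)) //= addKn big1 ?addr0 // => i.
rewrite -val_eqE /= neq_ltn => /orP[lti|gti].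
  by rewrite pcoef_lt_ord ?mul0r.
rewrite [g _]pcoef_lt_ord ?mulr0 // ltn_subLR; last by rewrite -ltnS.
by rewrite ltn_add2r.
Qed.

Lemma pcoefM_lt_ord (f g : powser) n :
  (n < ord f + ord g)%N -> (f * g) n = 0.
Proof.
move=> ltn; rewrite pcoefM big1 // => i _.
have [lti|gei] := ltnP i (ord f); first by rewrite pcoef_lt_ord ?mul0r.
rewrite [g _]pcoef_lt_ord ?mulr0 // ltn_subLR; last by rewrite -ltnS.
by apply: leq_trans ltn _; rewrite leq_add2r.
Qed.

Lemma ordM (f g : powser) : f != 0 -> g != 0 -> ord (f * g) = (ord f + ord g)%N.
Proof.
move=> f0 g0; apply: ordP; last by move=> i; apply: pcoefM_lt_ord.
by rewrite pcoefM_ord mulf_neq0 ?pcoef_ord.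
Qed.

Definition powser_unit : {pred powser} := fun f => `[< exists g, g * f = 1 >].
Definition powser_inv (f : powser) : powser :=
  if pselect (exists g, g * f = 1) is left h then sval (cid h) else f.

Let powser_mulVx : {in powser_unit, left_inverse 1 powser_inv *%R}.
Proof.
move=> f /asboolP h; rewrite /powser_inv; case: pselect => // h'.
by case: cid.
Qed.
Let powser_unitPl (f g : powser) : g * f = 1 -> powser_unit f.
Proof. by move=> gf; apply/asboolP; exists g. Qed.
Let powser_invr_out : {in [predC powser_unit], powser_inv =1 id}.
Proof. by move=> f /asboolPn h; rewrite /powser_inv; case: pselect. Qed.

HB.instance Definition _ := GRing.ComNzRing_hasMulInverse.Build powser
  powser_mulVx powser_unitPl powser_invr_out.

Let powser_idomain : GRing.integral_domain_axiom powser.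
Proof.
move=> f g fg0; apply: contrapT => /negP; rewrite negb_or => /andP[f0 g0].
have := pcoefM_ord f g; rewrite fg0 pcoef0 => /esym/eqP.
by rewrite mulf_eq0 !(negbTE (pcoef_ord _)).
Qed.

HB.instance Definition _ := GRing.ComUnitRing_isIntegral.Build powser
  powser_idomain.

Definition powser_of_poly (p : {poly F}) : powser := Powser (fun n => p`_n).

Let powser_of_poly_zmod : zmod_morphism powser_of_poly.
Proof. by move=> p q; apply: powserP => n /=; rewrite coefB. Qed.
Let powser_of_poly_monoid : monoid_morphism powser_of_poly.
Proof.
split; first by apply: powserP => n /=; rewrite coef1.
by move=> p q; apply: powserP => n; rewrite /= coefM.
Qed.
HB.instance Definition _ :=
  GRing.isZmodMorphism.Build {poly F} powser powser_of_poly powser_of_poly_zmod.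
HB.instance Definition _ :=
  GRing.isMonoidMorphism.Build {poly F} powser powser_of_poly
    powser_of_poly_monoid.

Lemma powser_of_poly_inj : injective powser_of_poly.
Proof.
by move=> p q pq; apply/polyP => i; have := congr1 (fun f => pcoef f i) pq.
Qed.

(* f(z) |-> f(z^m), for m > 0 *)
Definition powser_subst (m : nat) (f : powser) : powser :=
  Powser (fun n => if (m %| n)%N then f (n %/ m)%N else 0).

End Powser.

(* The extension x / y |-> g x / g y of g to the fraction field; it is used
   for injective g only. *)
Section FracLift.
Variables (A : idomainType) (E : fieldType).

Definition fraclift (g : A -> E) (x : {fraction A}) : E :=
  g \n_(repr x) / g \d_(repr x).

Lemma frac_numden (x : {fraction A}) :
  x = (\n_(repr x))%:F / (\d_(repr x))%:F.
Proof.
have d0 : (\d_(repr x))%:F != 0 by rewrite tofrac_eq0 denom_ratioP.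
apply: (mulIf d0); rewrite divfK //.
rewrite -{1}[x]reprK; unlock FracField.tofrac; rewrite -[LHS]FracField.pi_mul.
apply/eqmodP => /=; rewrite FracField.equivfE /FracField.mulf.
by rewrite !numden_Ratio ?mulr1 ?mul1r ?oner_neq0 ?denom_ratioP // mulrC.
Qed.

Variable g : {rmorphism A -> E}.
Hypothesis g_inj : injective g.

Let g_neq0 a : a != 0 -> g a != 0.
Proof. by rewrite -(rmorph0 g) (inj_eq g_inj). Qed.

Lemma fraclift_div (a b : A) : b != 0 -> fraclift g (a%:F / b%:F) = g a / g b.
Proof.
move=> b0; rewrite /fraclift.
set x := a%:F / b%:F.
have d0 := denom_ratioP (repr x).
have := frac_numden x; rewrite {1}/x.
move/eqP; rewrite eqr_div ?tofrac_eq0 // -!rmorphM tofrac_eq => /eqP e.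
by apply/eqP; rewrite eqr_div ?g_neq0 // -!rmorphM e.
Qed.

Lemma fraclift_tofrac (a : A) : fraclift g a%:F = g a.
Proof.
by rewrite -[a%:F]divr1 -(rmorph1 (@FracField.tofrac A)) fraclift_div
  ?oner_neq0 // rmorph1 divr1.
Qed.

Lemma fraclift_zmod : zmod_morphism (fraclift g).
Proof.
move=> x y; rewrite (frac_numden x) (frac_numden y).
set a := \n_(repr x); set b := \d_(repr x).
set c := \n_(repr y); set d := \d_(repr y).
have b0 : b != 0 := denom_ratioP _; have d0 : d != 0 := denom_ratioP _.
rewrite -mulNr addf_div ?tofrac_eq0 // -rmorphN -!rmorphM -rmorphD.
rewrite !fraclift_div ?mulf_neq0 //.
by rewrite -mulNr addf_div ?g_neq0 // rmorphD !rmorphM rmorphN.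
Qed.

Lemma fraclift_monoid : monoid_morphism (fraclift g).
Proof.
split; first by rewrite -(rmorph1 (@FracField.tofrac A)) fraclift_tofrac rmorph1.
move=> x y; rewrite (frac_numden x) (frac_numden y).
set a := \n_(repr x); set b := \d_(repr x).
set c := \n_(repr y); set d := \d_(repr y).
have b0 : b != 0 := denom_ratioP _; have d0 : d != 0 := denom_ratioP _.
rewrite mulf_div -!rmorphM !fraclift_div ?mulf_neq0 //.
by rewrite mulf_div !rmorphM.
Qed.

End FracLift.

Notation ratfun F := {fraction {poly F}}.
Notation laurent F := {fraction (powser F)}.

(* F(z) as a subfield of F((z)) *)
Section RatfunLaurent.
Variable F : fieldType.

Let emb : {rmorphism {poly F} -> laurent F} :=
  (@FracField.tofrac (powser F) \o @powser_of_poly F)%FUN.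

Let emb_inj : injective emb.
Proof.
by move=> p q /= /eqP; rewrite tofrac_eq => /eqP/powser_of_poly_inj.
Qed.

Definition laurent_of_ratfun : ratfun F -> laurent F :=
  fraclift (fun p => (powser_of_poly p)%:F).

HB.instance Definition _ := GRing.isZmodMorphism.Build (ratfun F) (laurent F)
  laurent_of_ratfun (fraclift_zmod emb_inj).
HB.instance Definition _ := GRing.isMonoidMorphism.Build (ratfun F) (laurent F)
  laurent_of_ratfun (fraclift_monoid emb_inj).

Lemma laurent_of_ratfun_poly (p : {poly F}) :
  laurent_of_ratfun p%:F = (powser_of_poly p)%:F.
Proof. exact: (fraclift_tofrac emb_inj). Qed.

End RatfunLaurent.

(* F(T) as a subfield of F((1/T)): the variable of [laurent F] stands here for
   1/T, so that the embedding is P(T) |-> P(X^-1) on polynomials. *)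
Section RatfunAtInfinity.
Variable F : fieldType.

Definition invT : laurent F := (powser_of_poly 'X)%:F.

Definition laurentV_of_poly (p : {poly F}) : laurent F :=
  (map_poly (fun c : F => (powser_of_poly c%:P)%:F) p).[invT^-1].

Let cst : {rmorphism F -> laurent F} :=
  (@FracField.tofrac (powser F) \o (@powser_of_poly F \o polyC))%FUN.

Let emb : {rmorphism {poly F} -> laurent F} :=
  (horner_eval invT^-1 \o map_poly cst)%FUN.

Lemma invT_neq0 : invT != 0.
Proof.
by rewrite tofrac_eq0 -(rmorph0 (@powser_of_poly F))
  (inj_eq (@powser_of_poly_inj F)) polyX_eq0.
Qed.

Definition revpoly (p : {poly F}) : {poly F} :=
  \poly_(i < size p) p`_((size p).-1 - i).

Lemma laurentV_of_polyE (p : {poly F}) :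
  laurentV_of_poly p = (powser_of_poly (revpoly p))%:F / invT ^+ (size p).-1.
Proof.
have [->|p0] := eqVneq p 0.
  rewrite /laurentV_of_poly map_poly0 horner0.
  have -> : revpoly 0 = 0.
    by apply/polyP => i; rewrite coef_poly size_poly0 !coef0 ltn0.
  by rewrite !rmorph0 mul0r.
have sp : size p = (size p).-1.+1 by rewrite prednK // size_poly_gt0.
apply/eqP; rewrite eq_sym -subr_eq0; apply/eqP.
have tn0 : invT ^+ (size p).-1 != 0 by rewrite expf_neq0 // invT_neq0.
apply: (mulIf tn0); rewrite mulrBl mul0r divfK //; apply/eqP.
rewrite subr_eq0; apply/eqP.
have -> : laurentV_of_poly p = (map_poly cst p).[invT^-1] by [].
rewrite horner_coef (size_map_poly cst) /revpoly poly_def.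
rewrite !rmorph_sum /= mulr_suml (reindex_inj rev_ord_inj) /=.
apply: eq_bigr => i _; rewrite coef_map /=.
have lei : (i <= (size p).-1)%N by rewrite -ltnS -sp.
have -> : ((size p).-1 - (size p - i.+1) = i)%N.
  by rewrite {2}sp subSS subKn.
rewrite -mul_polyC !rmorphM !rmorphXn -/invT -mulrA; congr (_ * _).
rewrite exprVn {1}sp subSS.
by rewrite -{2}(subnK lei) exprD mulrCA mulVf ?mulr1 // expf_neq0 ?invT_neq0.
Qed.

Lemma revpoly0 (p : {poly F}) : p != 0 -> (revpoly p)`_0 = lead_coef p.
Proof. by move=> p0; rewrite coef_poly size_poly_gt0 p0 subn0. Qed.

Let emb_inj : injective emb.
Proof.
apply: raddf_inj => p e; apply/eqP; apply: contrapT => /negP p0.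
have := laurentV_of_polyE p; rewrite [laurentV_of_poly p]e => /esym/eqP.
rewrite mulf_eq0 invr_eq0 expf_eq0 (negbTE invT_neq0) andbF orbF tofrac_eq0.
rewrite -(rmorph0 (@powser_of_poly F)) (inj_eq (@powser_of_poly_inj F)).
move=> /eqP r0; have := revpoly0 p0; rewrite r0 coef0 => /esym/eqP.
by rewrite lead_coef_eq0 (negbTE p0).
Qed.

Definition laurentV_of_ratfun : ratfun F -> laurent F :=
  fraclift laurentV_of_poly.

HB.instance Definition _ := GRing.isZmodMorphism.Build (ratfun F) (laurent F)
  laurentV_of_ratfun (fraclift_zmod emb_inj).
HB.instance Definition _ := GRing.isMonoidMorphism.Build (ratfun F) (laurent F)
  laurentV_of_ratfun (fraclift_monoid emb_inj).

Lemma laurentV_of_ratfun_poly (p : {poly F}) :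
  laurentV_of_ratfun p%:F = laurentV_of_poly p.
Proof. exact: (fraclift_tofrac emb_inj). Qed.

End RatfunAtInfinity.

Section AbsoluteValues.
Variable R : realType.

Record absolute_value (E : fieldType) (v : E -> R) : Prop := AbsoluteValue {
  absv_ge0 : forall x, 0 <= v x;
  absv_eq0 : forall x, v x = 0 <-> x = 0;
  absvM : forall x y, v (x * y) = v x * v y;
  absvD : forall x y, v (x + y) <= Num.max (v x) (v y) }.

Definition absv_cvg (E : fieldType) (v : E -> R) (u : nat -> E) (l : E) :=
  ((fun n => v (u n - l)) @ \oo --> (0 : R))%classic.

Definition absv_cauchy (E : fieldType) (v : E -> R) (u : nat -> E) :=
  forall e : R, 0 < e ->
    exists N, forall m n, (N <= m)%N -> (N <= n)%N -> v (u m - u n) < e.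

Record completion (A C : fieldType) (vA : A -> R) (vC : C -> R) (j : A -> C)
    : Prop := Completion {
  completion_isometry : forall x, vC (j x) = vA x;
  completion_dense : forall (x : C) (e : R), 0 < e -> exists a, vC (x - j a) < e;
  completion_complete : forall u : nat -> C, absv_cauchy vC u ->
    exists l, absv_cvg vC u l }.

(* the absolute value on F_q((X)), normalized by |X| = 1/q *)
Definition powser_abs (F : finFieldType) (f : powser F) : R :=
  if f == 0 then 0 else #|F|%:R ^- ord f.

Definition laurent_abs (F : finFieldType) (x : laurent F) : R :=
  powser_abs \n_(repr x) / powser_abs \d_(repr x).

Section Laurent.
Variable F : finFieldType.

Let q_neq0 n : #|F|%:R ^- n != 0 :> R.
Proof.
rewrite invr_eq0 expf_neq0 // pnatr_eq0 -lt0n.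
exact: ltnW (finNzRing_gt1 F).
Qed.

Lemma powser_abs_neq0 (f : powser F) : f != 0 -> powser_abs f != 0.
Proof. by move=> f0; rewrite /powser_abs (negbTE f0) q_neq0. Qed.

Lemma powser_absM (f g : powser F) :
  powser_abs (f * g) = powser_abs f * powser_abs g.
Proof.
rewrite /powser_abs mulf_eq0.
have [->|f0] := eqVneq f 0; first by rewrite /= mul0r.
have [->|g0] := eqVneq g 0; first by rewrite /= mulr0.
by rewrite /= ordM // exprD invfM.
Qed.

Lemma laurent_abs_div (f g : powser F) : g != 0 ->
  laurent_abs (f%:F / g%:F) = powser_abs f / powser_abs g.
Proof.
move=> g0; rewrite /laurent_abs.
set x := f%:F / g%:F.
have d0 := denom_ratioP (repr x).
have := frac_numden x; rewrite {1}/x.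
move/eqP; rewrite eqr_div ?tofrac_eq0 // -!rmorphM tofrac_eq => /eqP e.
by apply/eqP; rewrite eqr_div ?powser_abs_neq0 // -!powser_absM e.
Qed.

(* On F_q(T) this is the usual 1/T-adic absolute value. *)
Lemma laurent_abs_poly (p : {poly F}) : p != 0 ->
  laurent_abs (laurentV_of_ratfun p%:F) = #|F|%:R ^+ (size p).-1.
Proof.
move=> p0; rewrite laurentV_of_ratfun_poly laurentV_of_polyE -rmorphXn.
have X0 : powser_of_poly 'X != 0 :> powser F.
  by rewrite -(tofrac_eq0 (powser_of_poly 'X)) invT_neq0.
rewrite laurent_abs_div ?expf_neq0 //.
have r0 : powser_of_poly (revpoly p) 0 != 0.
  by rewrite /= revpoly0 // lead_coef_eq0.
rewrite /powser_abs expf_eq0 (negbTE X0) andbF.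
case: eqP => [e|_]; first by rewrite e pcoef0 eqxx in r0.
rewrite (@ordP _ _ 0%N) //.
rewrite (@ordP _ _ (size p).-1) ?expr0 ?invr1 ?div1r ?invrK //.
  by rewrite -rmorphXn /= coefXn eqxx oner_neq0.
by move=> i lti; rewrite -rmorphXn /= coefXn ltn_eqF.
Qed.

End Laurent.

(* the power series over L, seen in C through iota, converges on some
   disc |z| < rho with rho > 0 *)
Definition convergent_near0 (L C : fieldType) (vC : C -> R) (iota : L -> C)
    (f : powser L) : Prop :=
  exists2 rho : R, 0 < rho & forall z : C, vC z < rho ->
    exists l : C, absv_cvg vC (fun N => \sum_(n < N) iota (f n) * z ^+ n) l.

End AbsoluteValues.

Section Mahler.
Variable L : fieldType.

Definition mahler (d : nat) (f : powser L) : Prop :=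
  exists n, exists2 P : 'I_n.+1 -> {poly L}, P ord_max != 0 &
    \sum_(i < n.+1) powser_of_poly (P i) * powser_subst (d ^ i) f = 0.

Definition transcendental_over_ratfun (f : powser L) : Prop :=
  ~ algebraicOver (@laurent_of_ratfun L) f%:F.

Definition in_ratfun (f : powser L) : Prop :=
  exists g : ratfun L, laurent_of_ratfun g = f%:F.

End Mahler.

(* Main.v *)
From HB Require Import structures.
Require Import Defs.
From mathcomp Require Import all_boot all_order all_algebra all_field.
From mathcomp Require Import boolp classical_sets reals topology normedtype
  sequences.
From mathcomp Require Import ring.

Set Implicit Arguments.
Unset Strict Implicit.
Unset Printing Implicit Defensive.

Import Order.TTheory GRing.Theory Num.Theory.
Import numFieldNormedType.Exports.

Local Open Scope ring_scope.

(** After embedding L in A we may work over an algebraically closed field F in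
which d is invertible.  Let f be algebraic and d-Mahler, and choose a nonzero
polynomial c such that g = c f is integral over F[z]; then g / z^N is integral
over F[1/z] for some N.

Let D = d^k.  The part h of g supported on the exponents congruent to e
modulo D is an average of the g(w z), w ranging over the D-th roots of unity, so
it is again integral over F[z], and h / z^N over F[1/z].  It has the form
z^e u(z^D), where u is a section of g.  Once the Mahler equation is normalized
so that the coefficient of f(z) is nonzero, the F(z)-span of the f(z^(d^j)) is
stable under sections; as it is spanned by finitely many algebraic functions,
its elements, and hence h, have degree at most some m independent of k.  By
Gauss's lemma the constant coefficient of the minimal polynomial of h over F(z)
is a polynomial of degree at most N m; since h divides it in F[[z]], h is zero
or vanishes at 0 to order at most N m.

Given e > N m, take k with d^k > e: the coefficient of z^e in g is the leading
one of h, so it is zero.  Thus g is a polynomial and f = g / c. *)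

(** * Fraction fields, Gauss's lemma and bounded degrees *)

Lemma map_inj_poly_eq0 (R S : nzRingType) (phi : {rmorphism R -> S})
    (P : {poly R}) :
  injective phi -> (map_poly phi P == 0) = (P == 0).
Proof.
move=> phi_inj.
by rewrite -!size_poly_eq0 (size_map_inj_poly phi_inj (rmorph0 _)).
Qed.

Section FractionPolynomials.
Variables (A : idomainType) (K : fieldType) (phi : {rmorphism A -> K}).
Hypothesis phi_inj : injective phi.
Hypothesis phi_frac : forall x, exists a b, b != 0 /\ x = phi a / phi b.

Lemma clear_denominators (p : {poly K}) :
  exists2 b, b != 0 & exists P : {poly A}, map_poly phi P = phi b *: p.
Proof.
elim/poly_ind: p => [|p c [b b0 [P PE]]].
  by exists 1; rewrite ?oner_eq0 //; exists 0; rewrite rmorph0 scaler0.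
have [a [e [e0 ->]]] := phi_frac c.
have pe0 : phi e != 0 by rewrite -(rmorph0 phi) (inj_eq phi_inj).
exists (b * e); first by rewrite mulf_neq0.
exists (e *: (P * 'X) + (b * a)%:P).
rewrite rmorphD /= map_polyZ map_polyC /= [map_poly phi (P * 'X)]rmorphM /=.
rewrite map_polyX PE -scalerAl scalerA -rmorphM mulrC scalerDr; congr (_ + _).
rewrite -mul_polyC -polyCM; congr _%:P.
by rewrite !rmorphM; field.
Qed.
End FractionPolynomials.

Section Gauss.
Variables (F : closedFieldType) (K : fieldType).
(** [K] is an abstract fraction field of F[z], because the lemma is needed for two embeddings into
    F(z): p |-> p(z) and p |-> p(1/z). *)
Variable phi : {rmorphism {poly F} -> K}.
Hypothesis phi_inj : injective phi.
Hypothesis phi_frac : forall x, exists a b, b != 0 /\ x = phi a / phi b.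

Let phi_eq0 a : (phi a == 0) = (a == 0).
Proof. by rewrite -{1}(rmorph0 phi) (inj_eq phi_inj). Qed.

Lemma divide_linear (U : {poly {poly F}}) (x : F) :
  map_poly (horner_eval x) U = 0 -> exists V, U = ('X - x%:P)%:P * V.
Proof.
move=> U0; exists (map_poly (fun c => c %/ ('X - x%:P)) U).
apply/polyP => i; rewrite coefCM coef_map_id0 ?div0p // mulrC divpK //.
rewrite dvdp_XsubCl; apply/rootP.
by have := congr1 (fun p : {poly F} => p`_i) U0; rewrite coef_map coef0.
Qed.

(* Gauss's lemma, in the form: F[z] is integrally closed.  Common zeros of
   denominators are removed one linear factor at a time. *)
Lemma monic_factor_integral (mu nu : {poly K}) (Q : {poly {poly F}}) :
  mu \is monic -> Q \is monic -> mu * nu = map_poly phi Q ->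
  exists P, mu = map_poly phi P.
Proof.
move=> mu1 Q1 muQ.
have nu1 : nu \is monic.
  by rewrite -(monicMl _ mu1) muQ monic_map.
have [a a0 [U UE]] := clear_denominators phi_inj phi_frac mu.
have [b b0 [V VE]] := clear_denominators phi_inj phi_frac nu.
have [n] := ubnP (size a + size b); elim: n a b U V a0 b0 UE VE => // n IHn.
move=> a b U V a0 b0 UE VE; rewrite ltnS => le_n.
(* The denominator of a monic polynomial reappears as the leading coefficient of its cleared form;
   [reduce] can therefore read the smaller denominator off the quotient by z - x. *)
have lc c W (w : {poly K}) : w \is monic -> map_poly phi W = phi c *: w ->
    lead_coef W = c.
  move=> /monicP w1 WE; apply: phi_inj.
  by rewrite -lead_coef_map_inj ?rmorph0 // WE lead_coefZ w1 mulr1.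
have reduce x c W (w : {poly K}) : w \is monic -> c != 0 ->
    map_poly phi W = phi c *: w -> map_poly (horner_eval x) W = 0 ->
    exists c' W', [/\ c' != 0, map_poly phi W' = phi c' *: w
                    & size c = (size c').+1].
  move=> w1 c0 WE /divide_linear[W' WW'].
  have cE : c = ('X - x%:P) * lead_coef W'.
    by rewrite -(lc _ _ _ w1 WE) WW' lead_coefM lead_coefC.
  have c'0 : lead_coef W' != 0.
    by apply: contraNneq c0 => e; rewrite cE e mulr0.
  exists (lead_coef W'), W'; split=> //; last first.
    by rewrite {1}cE size_mul ?polyXsubC_eq0 // size_XsubC.
  have x0 : phi ('X - x%:P) != 0 by rewrite phi_eq0 polyXsubC_eq0.
  apply: (@mulfI _ (phi ('X - x%:P))%:P); first by rewrite polyC_eq0.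
  rewrite -map_polyC -rmorphM /= -WW' WE cE rmorphM.
  by rewrite map_polyC -scalerA mul_polyC.
have [/eqP sa|sa] := eqVneq (size a) 1.
  have [c c0 ac] := size_poly1P _ sa.
  exists (c^-1%:P *: U); rewrite map_polyZ /= UE scalerA ac -rmorphM -polyCM.
  by rewrite mulVf // rmorph1 scale1r.
have [x ax] := closed_rootP a sa.
have UV : U * V = (a * b) *: Q.
  apply: (@map_inj_poly _ _ phi) => //; first exact: rmorph0.
  rewrite rmorphM /= map_polyZ /= UE VE -muQ rmorphM.
  by rewrite -scalerAl -scalerAr scalerA.
(* At the root x of a, the product U V = a b Q becomes zero. Polynomials over F form a domain, so U
   or V has all its coefficients divisible by z - x. *)
have: map_poly (horner_eval x) U * map_poly (horner_eval x) V = 0.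
  rewrite -rmorphM UV /= map_polyZ /= rmorphM /= /horner_eval (rootP ax).
  by rewrite mul0r scale0r.
move/eqP; rewrite mulf_eq0 => /orP[]/eqP.
  move/(reduce _ _ _ _ mu1 a0 UE) => [a' [U' [a'0 UE' sE]]].
  by apply: (IHn a' b U' V) => //; rewrite sE in le_n.
move/(reduce _ _ _ _ nu1 b0 VE) => [b' [V' [b'0 VE' sE]]].
by apply: (IHn a b' U V') => //; rewrite sE addnS in le_n.
Qed.
End Gauss.

Section Span.
Variables (K E : fieldType) (emb : {rmorphism K -> E}).

Definition lin_span (I : finType) (e : I -> E) (g : E) :=
  exists c : I -> K, g = \sum_i emb (c i) * e i.

Lemma lin_span0 (I : finType) (e : I -> E) : lin_span e 0.
Proof. by exists (fun=> 0); rewrite big1 // => i _; rewrite rmorph0 mul0r. Qed.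

Lemma lin_spanD (I : finType) (e : I -> E) g h :
  lin_span e g -> lin_span e h -> lin_span e (g + h).
Proof.
move=> [a ->] [b ->]; exists (fun i => a i + b i).
by rewrite -big_split; apply: eq_bigr => i _; rewrite rmorphD mulrDl.
Qed.

Lemma lin_spanZ (I : finType) (e : I -> E) r g :
  lin_span e g -> lin_span e (emb r * g).
Proof.
move=> [a ->]; exists (fun i => r * a i); rewrite mulr_sumr.
by apply: eq_bigr => i _; rewrite rmorphM mulrA.
Qed.

Lemma lin_span_sum (I : finType) (e : I -> E) (J : Type) (s : seq J)
    (P : pred J) (u : J -> E) :
  (forall j, P j -> lin_span e (u j)) -> lin_span e (\sum_(j <- s | P j) u j).
Proof.
by move=> ue; apply: big_ind => //; [exact: lin_span0 | exact: lin_spanD].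
Qed.

Lemma lin_span_gen (I : finType) (e : I -> E) i : lin_span e (e i).
Proof.
exists (fun j => (j == i)%:R); rewrite (bigD1 i) //= eqxx rmorph1 mul1r.
by rewrite big1 ?addr0 // => j /negbTE ->; rewrite rmorph0 mul0r.
Qed.

Lemma lin_span_stable (I : finType) (e : I -> E) g u :
  (forall i, lin_span e (g * e i)) -> lin_span e u -> lin_span e (g * u).
Proof.
move=> ge [c ->]; rewrite mulr_sumr; apply: lin_span_sum => i _.
by rewrite mulrCA; apply: lin_spanZ.
Qed.

(** The #|I| + 1 powers 1, g, ..., g^#|I| all lie in a span of #|I| elements, so a nonzero row in
    the left kernel of their coefficient matrix gives the polynomial. *)
Lemma lin_span_root (I : finType) (e : I -> E) g :
  lin_span e 1 -> (forall i, lin_span e (g * e i)) ->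
  exists P : {poly K}, [/\ P != 0, (size P <= #|I|.+1)%N
    & root (map_poly emb P) g].
Proof.
move=> e1 ge.
have gX k : lin_span e (g ^+ k).
  by elim: k => // k IHk; rewrite exprS; apply: lin_span_stable.
pose c k := projT1 (cid (gX k)).
have cE k : g ^+ k = \sum_i emb (c k i) * e i := projT2 (cid (gX k)).
pose M := \matrix_(k < #|I|.+1, j < #|I|) c k (enum_val j).
have : kermx M != 0.
  rewrite kermx_eq0 /row_free neq_ltn ltnS.
  by rewrite (leq_trans (rank_leq_col M)).
case/rowV0Pn => v /sub_kermxP vM v0.
exists (\poly_(k < #|I|.+1) v 0 (inord k)); split.
- apply: contraNneq v0 => p0; apply/eqP/rowP => k; rewrite mxE.
  have := congr1 (fun p : {poly K} => p`_k) p0.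
  by rewrite coef_poly ltn_ord inord_val coef0.
- exact: size_poly.
apply/rootP; rewrite (@horner_coef_wide _ #|I|.+1); last first.
  by rewrite (leq_trans (size_poly _ _)) // size_poly.
under eq_bigr => k _.
  rewrite coef_map coef_poly ltn_ord inord_val /= cE mulr_sumr.
  under eq_bigr do rewrite mulrA -rmorphM.
  over.
rewrite exchange_big /= big1 // => i _.
rewrite -mulr_suml -rmorph_sum /=.
have := congr1 (fun w : 'rV[K]_#|I| => w 0 (enum_rank i)) vM.
rewrite !mxE => vMi.
suff -> : \sum_(k < #|I|.+1) v 0 k * c k i = 0 by rewrite rmorph0 mul0r.
by rewrite -[RHS]vMi; apply: eq_bigr => k _; rewrite mxE enum_rankK.
Qed.

(** The generators are the monomials in the elements of [s], each exponent being smaller than the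
    degree of a monic equation of its element. *)
Lemma algebraic_span (s : seq E) : {in s, forall y, algebraicOver emb y} ->
  exists (I : finType) (e : I -> E),
    lin_span e 1 /\ {in s, forall y i, lin_span e (y * e i)}.
Proof.
elim: s => [_|y s IHs alg_s].
  exists unit, (fun=> 1); split=> //; exact: (@lin_span_gen _ (fun=> 1) tt).
have [|I [e [e1 es]]] := IHs.
  by move=> x xs; apply: alg_s; rewrite inE xs orbT.
have /integral_algebraic[p p1 py] := alg_s y (mem_head _ _).
pose n := (size p).-1.
have sp : size p = n.+1 by rewrite prednK // size_poly_gt0 monic_neq0.
(* A monic constant is 1 and has no root. Without this, the exponents ['I_n] would be empty and 1
   would be lost from the span. *)
have n0 : (0 < n)%N.
  rewrite lt0n; apply/eqP => n0; have /size1_polyC pE : (size p <= 1)%N.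
    by rewrite sp n0.
  move: p1 py; rewrite pE monicE lead_coefC => /eqP ->.
  by rewrite rmorph1 rootE hornerE oner_eq0.
pose e' (ij : I * 'I_n) := e ij.1 * y ^+ ij.2.
have lift u j : (j < n)%N -> lin_span e u -> lin_span e' (u * y ^+ j).
  move=> jn [c ->]; rewrite mulr_suml; apply: lin_span_sum => i _.
  by rewrite -mulrA; apply/lin_spanZ/(@lin_span_gen _ e' (i, Ordinal jn)).
exists (I * 'I_n)%type, e'; split.
  by rewrite -[1]mulr1 -(expr0 y); apply: lift.
move=> x; rewrite inE => /orP[/eqP->|xs] [i j]; last first.
  by rewrite /e' mulrA; apply: lift => //; apply: es.
rewrite /e' mulrCA -exprS /=.
have [jn|] := ltnP j.+1 n; first by apply: lift => //; exact: lin_span_gen.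
rewrite leq_eqVlt ltnS leqNgt ltn_ord orbF => /eqP <-.
(* The top power is rewritten by the monic equation of y. *)
have : y ^+ n = - \sum_(k < n) emb p`_k * y ^+ k.
  apply/eqP; rewrite -addr_eq0 addrC; apply/eqP.
  rewrite -[RHS](rootP py) (@horner_coef_wide _ n.+1) ?size_map_poly ?sp //.
  rewrite big_ord_recr /= !coef_map /= -[p`_n]/(lead_coef p) (monicP p1).
  rewrite rmorph1 mul1r.
  by congr (_ + _); apply: eq_bigr => k _; rewrite coef_map.
move=> ->; rewrite -mulN1r -(rmorphN1 emb) mulrCA; apply: lin_spanZ.
rewrite mulr_sumr; apply: lin_span_sum => k _.
by rewrite mulrCA; apply/lin_spanZ/lift => //; exact: lin_span_gen.
Qed.

(** Every combination of the [y i] stabilizes one and the same finite span, hence a bound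
    independent of the coefficients [r]. *)
Lemma algebraic_bounded_degree (n : nat) (y : 'I_n -> E) :
  (forall i, algebraicOver emb (y i)) ->
  exists m, forall r : 'I_n -> K, exists P : {poly K},
    [/\ P != 0, (size P <= m)%N
      & root (map_poly emb P) (\sum_i emb (r i) * y i)].
Proof.
move=> alg_y; have [|I [e [e1 ey]]] := @algebraic_span (codom y).
  by move=> _ /codomP[i ->].
exists #|I|.+1 => r; apply: (lin_span_root e1) => i; rewrite mulr_suml.
apply: lin_span_sum => j _; rewrite -mulrA; apply/lin_spanZ/ey; exact: codom_f.
Qed.
End Span.

(** * Power series: sections, dilations and residue parts *)

Section PowerSeries.
Variable F : fieldType.
Implicit Types (f g u : powser F) (p : {poly F}).

Lemma pcoef_sum (I : Type) (r : seq I) (P : pred I) (G : I -> powser F) n :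
  (\sum_(i <- r | P i) G i) n = \sum_(i <- r | P i) G i n.
Proof. by elim/big_rec2: _ => // i x y _ <-; rewrite pcoefD. Qed.

Lemma pcoefCM (c : F) f n : (powser_of_poly c%:P * f) n = c * f n.
Proof.
rewrite pcoefM big_ord_recl /= subn0 coefC /= big1 ?addr0 // => i _.
by rewrite coefC mul0r.
Qed.

(** The section, or Cartier, operator: for m > 0, f(z) is the sum over e < m of z^e times its e-th
    section at z^m. *)
Definition powser_section (m e : nat) f := Powser (fun n => f (m * n + e)%N).

Lemma powser_section_zmod m e : zmod_morphism (powser_section m e).
Proof. by move=> f g; apply: powserP. Qed.
HB.instance Definition _ m e := GRing.isZmodMorphism.Build
  (powser F) (powser F) (powser_section m e) (powser_section_zmod m e).

(** The bound [size p] is crude but sufficient for m > 0, since then m n + e >= n. *)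
Definition poly_section (m e : nat) p : {poly F} :=
  \poly_(n < size p) p`_(m * n + e).

Lemma powser_section_poly m e p : (0 < m)%N ->
  powser_section m e (powser_of_poly p) = powser_of_poly (poly_section m e p).
Proof.
move=> m0; apply: powserP => n /=; rewrite coef_poly.
case: ltnP => // le_n; rewrite nth_default // (leq_trans le_n) //.
by rewrite (leq_trans (leq_pmull n m0)) // leq_addr.
Qed.

(** This reindexes a Cauchy product with u(z^m), in which only the indices divisible by m
    contribute. *)
Lemma sum_multiples (V : nmodType) (m N : nat) (G : nat -> V) : (0 < m)%N ->
  \sum_(k < N.+1 | (m %| k)%N) G (k %/ m)%N = \sum_(l < (N %/ m).+1) G l.
Proof.
move=> m0; elim: N => [|N IHN].
  by rewrite div0n !big_mkcond !big_ord_recl !big_ord0 /= dvdn0 div0n.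
rewrite big_mkcond big_ord_recr -big_mkcond /= IHN divnS //.
case: ifP => mN; last by rewrite addr0.
by rewrite mN add1n [RHS]big_ord_recr.
Qed.

Lemma powser_sectionM m e f u : (e < m)%N ->
  powser_section m e (f * powser_subst m u) = powser_section m e f * u.
Proof.
move=> em; have m0 : (0 < m)%N by case: m em.
apply: powserP => n; rewrite [f * _]mulrC [_ * u]mulrC /=.
have -> : n.+1 = ((m * n + e) %/ m).+1.
  by rewrite mulnC divnMDl // divn_small ?addn0.
rewrite -(@sum_multiples _ _ _ (fun l => u l * f (m * (n - l) + e)%N)) //.
rewrite [RHS]big_mkcond; apply: eq_bigr => k _; case: ifP => [/dvdnP[l lk]|_].
  rewrite lk mulnK //; congr (_ * f _).
  have : (l <= n)%N.
    have := ltn_ord k; rewrite lk ltnS => /(leq_div2r m).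
    by rewrite mulnK // mulnC divnMDl // divn_small // addn0.
  by move=> ln; rewrite mulnBr -addnBAC ?[(l * m)%N]mulnC // leq_mul.
by rewrite mul0r.
Qed.

Lemma powser_section_subst m e f : (e < m)%N ->
  powser_section m e (powser_subst m f) = if e == 0 then f else 0.
Proof.
move=> em; have m0 : (0 < m)%N by case: m em.
apply: powserP => n; rewrite /= dvdn_addr ?dvdn_mulr //.
case: eqVneq => [->|e0]; first by rewrite dvdn0 addn0 mulKn.
by rewrite /dvdn modn_small // (negbTE e0).
Qed.

(** An extensionality principle: identities involving z^m are checked one section at a time, where
    [powser_sectionM] applies. *)
Lemma powser_section_inj m f g : (0 < m)%N ->
  (forall e, (e < m)%N -> powser_section m e f = powser_section m e g) -> f = g.
Proof.
move=> m0 fg; apply: powserP => n.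
have := congr1 (fun h => pcoef h (n %/ m)) (fg (n %% m)%N (ltn_pmod n m0)).
by rewrite /= mulnC -divn_eq.
Qed.

(** The exponent is written as a successor so that the morphism structures carry no side
    condition. *)
Lemma powser_subst_zmod m : zmod_morphism (@powser_subst F m.+1).
Proof.
by move=> f g; apply: powserP => n /=; case: ifP => //; rewrite subr0.
Qed.

Lemma powser_subst_monoid m : monoid_morphism (@powser_subst F m.+1).
Proof.
split=> [|f g]; apply: (@powser_section_inj m.+1) => // e em.
  rewrite powser_section_subst //; apply: powserP => n.
  case: eqVneq => [->|e0] /=; first by rewrite addn0 muln_eq0.
  by rewrite addn_eq0 (negbTE e0) andbF.
rewrite powser_sectionM // !powser_section_subst //.
by case: eqP; rewrite ?mul0r.
Qed.

HB.instance Definition _ m := GRing.isZmodMorphism.Build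
  (powser F) (powser F) (powser_subst m.+1) (powser_subst_zmod m).
HB.instance Definition _ m := GRing.isMonoidMorphism.Build
  (powser F) (powser F) (powser_subst m.+1) (powser_subst_monoid m).

Lemma powser_subst_poly m p : (0 < m)%N ->
  powser_subst m (powser_of_poly p) = powser_of_poly (p \Po 'X^m).
Proof.
by move=> m0; apply: powserP => n /=; rewrite coef_comp_poly_Xn.
Qed.

Lemma powser_substA (m n : nat) f : (0 < m)%N -> (0 < n)%N ->
  powser_subst m (powser_subst n f) = powser_subst (m * n) f.
Proof.
move=> m0 n0; apply: powserP => k /=.
case: (boolP (m %| k)%N) => [/dvdnP[l ->]|mk].
  by rewrite mulnK // [(l * m)%N]mulnC dvdn_pmul2l // divnMl.
by case: ifP => // /(dvdn_trans (dvdn_mulr n (dvdnn m))); rewrite (negbTE mk).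
Qed.

Lemma powser_subst1 f : powser_subst 1 f = f.
Proof. by apply: powserP => n; rewrite /= dvd1n divn1. Qed.

Lemma root_subst m (P : {poly {poly F}}) f : (0 < m)%N ->
  root (map_poly (@powser_of_poly F) P) f ->
  root (map_poly (@powser_of_poly F) (map_poly (comp_poly 'X^m) P))
    (powser_subst m f).
Proof.
case: m => // m _ Pf.
rewrite -map_poly_comp.
rewrite (eq_map_poly (g := powser_subst m.+1 \o @powser_of_poly F)).
  by rewrite map_poly_comp rmorph_root.
by move=> p /=; rewrite powser_subst_poly.
Qed.

(** The substitution f(z) |-> f(x z). *)
Definition twist (x : F) f := Powser (fun n => x ^+ n * f n).

Lemma twist_zmod x : zmod_morphism (twist x).
Proof. by move=> f g; apply: powserP => n /=; rewrite mulrBr. Qed.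

Lemma twist_monoid x : monoid_morphism (twist x).
Proof.
split=> [|f g]; apply: powserP => n /=.
  by case: n => [|n]; rewrite ?mulr1 ?mulr0.
rewrite mulr_sumr; apply: eq_bigr => i _.
by rewrite mulrACA -exprD subnKC // -ltnS.
Qed.

HB.instance Definition _ x := GRing.isZmodMorphism.Build
  (powser F) (powser F) (twist x) (twist_zmod x).
HB.instance Definition _ x := GRing.isMonoidMorphism.Build
  (powser F) (powser F) (twist x) (twist_monoid x).

Lemma twist_inj x : x != 0 -> injective (twist x).
Proof.
move=> x0 f g fg; apply: powserP => n.
have /mulfI := congr1 (fun h => pcoef h n) fg; apply.
by rewrite expf_neq0.
Qed.

Lemma twist_poly x p :
  twist x (powser_of_poly p) = powser_of_poly (p \Po (x *: 'X)).
Proof.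
apply: powserP => n /=; rewrite comp_polyE coef_sum.
under eq_bigr do rewrite exprZn !coefZ coefXn.
have [lt_n|le_n] := ltnP n (size p); last first.
  rewrite nth_default // mulr0 big1 // => i _.
  by rewrite gtn_eqF ?mulr0 // (leq_trans _ le_n).
rewrite (bigD1 (Ordinal lt_n)) //= eqxx mulr1 mulrC big1 ?addr0 // => i.
by rewrite -val_eqE eq_sym => /negbTE /= ->; rewrite !mulr0.
Qed.

Definition residue_part (m e : nat) f :=
  Powser (fun n => if (n %% m)%N == e then f n else 0).

Lemma residue_part_section m e f : (e < m)%N ->
  residue_part m e f =
    powser_of_poly 'X^e * powser_subst m (powser_section m e f).
Proof.
move=> em; have m0 : (0 < m)%N by case: m em.
apply: (@powser_section_inj m) => // i im.
rewrite powser_sectionM // powser_section_poly //; apply: powserP => n.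
have -> : poly_section m i 'X^e = (i == e)%:R.
  apply/polyP => k; rewrite coef_poly size_polyXn coefMn coef1 !coefXn ltnS.
  have [->|ie] := eqVneq i e.
    rewrite mulr1n; case: k => [|k]; first by rewrite muln0 eqxx.
    case: ifP => // _; rewrite -[X in _ == X]add0n eqn_add2r muln_eq0.
    by rewrite (gtn_eqF m0).
  rewrite mulr0n; case: ifP => // _; case: eqP => // ke; case/eqP: ie.
  by rewrite -(modn_small em) -ke mulnC modnMDl modn_small.
rewrite rmorph_nat mulr_natl /=.
rewrite mulnC modnMDl modn_small // mulnC.
by have [->|] := eqVneq i e; rewrite ?mulr1n ?mulr0n.
Qed.

Lemma primitive_root_neq0 m z : m.-primitive_root z -> z != 0 :> F.
Proof.
move=> z_prim; apply: contraTneq (oner_neq0 F) => z0.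
have := prim_expr_order z_prim; rewrite z0 expr0n => <-.
by rewrite gtn_eqF ?eqxx // (prim_order_gt0 z_prim).
Qed.

(** Discrete Fourier inversion: on the coefficient of z^n the sum becomes that of the powers of w =
    [z ^+ n / z ^+ e], which is m if n is congruent to e modulo m and 0 otherwise. *)
Lemma residue_part_twist m e f z : (e < m)%N -> m.-primitive_root z ->
  residue_part m e f = \sum_(k < m)
    powser_of_poly ((m%:R^-1 * (z ^+ e)^-1 ^+ k)%:P) * twist (z ^+ k) f.
Proof.
move=> em z_prim; apply: powserP => n; rewrite pcoef_sum.
(* A primitive m-th root of unity can exist only if m is invertible in F. *)
have m0 := prim_root_natf_neq0 z_prim.
have z0 := primitive_root_neq0 z_prim.
pose w := z ^+ n / z ^+ e.
have wm : w ^+ m = 1.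
  by rewrite exprMn exprVn -!exprM ![(_ * m)%N]mulnC !exprM
    (prim_expr_order z_prim) !expr1n divr1.
have w1 : (w == 1) = ((n %% m)%N == e).
  rewrite -[1](divff (expf_neq0 e z0)) (inj_eq (mulIf _)).
    by rewrite (eq_prim_root_expr z_prim) (modn_small em).
  by rewrite invr_eq0 expf_neq0.
transitivity (m%:R^-1 * f n * \sum_(k < m) w ^+ k); last first.
  rewrite mulr_sumr; apply: eq_bigr => k _.
  rewrite pcoefCM /= -exprM mulnC exprM exprMn; ring.
rewrite /= -w1; have [->|nw1] := eqVneq w 1.
  under eq_bigr do rewrite expr1n.
  by rewrite sumr_const card_ord mulrAC mulVf ?mul1r.
suff -> : \sum_(k < m) w ^+ k = 0 by rewrite mulr0.
have := subrX1 w m; rewrite wm subrr => /esym/eqP.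
by rewrite mulf_eq0 subr_eq0 (negbTE nw1) => /eqP.
Qed.
End PowerSeries.

(** * Laurent series and integrality over F[z] and F[1/z] *)

Section Laurent.
Variable F : fieldType.

Local Notation emb := (@laurent_of_ratfun F).

Definition laurent_of_poly : {rmorphism {poly F} -> laurent F} :=
  (@FracField.tofrac (powser F) \o @powser_of_poly F)%FUN.

(** The map p |-> p(1/z), with image F[1/z]; it presents integrality at infinity as integrality over
    a polynomial ring. *)
Definition poly_atV : {rmorphism {poly F} -> ratfun F} :=
  (horner_eval ('X%:F)^-1
    \o map_poly (@FracField.tofrac {poly F} \o polyC))%FUN.

Definition laurent_of_polyV : {rmorphism {poly F} -> laurent F} :=
  (emb \o poly_atV)%FUN.

Lemma laurent_of_poly_emb p : laurent_of_poly p = emb p%:F.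
Proof. by rewrite laurent_of_ratfun_poly. Qed.

Lemma poly_atVC (c : F) : poly_atV c%:P = c%:P%:F.
Proof. by rewrite /= /horner_eval map_polyC hornerC. Qed.

Lemma poly_atVX : poly_atV 'X = ('X%:F)^-1.
Proof. by rewrite /= /horner_eval map_polyX hornerX. Qed.

Lemma laurent_of_polyVC (c : F) :
  laurent_of_polyV c%:P = laurent_of_poly c%:P.
Proof. by rewrite laurent_of_poly_emb -poly_atVC. Qed.

Lemma laurent_of_polyVX : laurent_of_polyV 'X = (laurent_of_poly 'X)^-1.
Proof. by rewrite laurent_of_poly_emb -fmorphV -poly_atVX. Qed.

Lemma X_neq0 : ('X : {poly F})%:F != 0 :> ratfun F.
Proof. by rewrite tofrac_eq0 polyX_eq0. Qed.

Lemma poly_atVE p : poly_atV p * 'X%:F ^+ (size p).-1 = (revpoly p)%:F.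
Proof.
(* Inside the Laurent series the identity is [laurentV_of_polyE], whose variable [invT] is z
   here. *)
apply: (fmorph_inj emb); rewrite rmorphM rmorphXn /=.
rewrite !laurent_of_ratfun_poly.
have -> : emb (horner_eval ('X%:F)^-1
    (map_poly (@FracField.tofrac {poly F} \o polyC) p)) = laurentV_of_poly p.
  rewrite /horner_eval -horner_map fmorphV /= laurent_of_ratfun_poly.
  rewrite -map_poly_comp; congr (_.[_]).
  by apply: eq_map_poly => c /=; rewrite laurent_of_ratfun_poly.
by rewrite laurentV_of_polyE divfK // expf_neq0 // invT_neq0.
Qed.

Lemma size_revpoly (p : {poly F}) : (size (revpoly p) <= size p)%N.
Proof. exact: size_poly. Qed.

Lemma poly_atV_inj : injective poly_atV.
Proof.
apply: raddf_inj => p p0; apply/eqP; apply: contraTT isT => pn0.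
have := poly_atVE p; rewrite p0 mul0r => /esym/eqP; rewrite tofrac_eq0 => /eqP.
move=> r0; have := revpoly0 pn0; rewrite r0 coef0 => /esym/eqP.
by rewrite lead_coef_eq0 (negbTE pn0).
Qed.

Lemma tofrac_inj : injective (@FracField.tofrac {poly F}).
Proof. by move=> p q /eqP; rewrite tofrac_eq => /eqP. Qed.

Lemma tofrac_frac (x : ratfun F) :
  exists a b : {poly F}, b != 0 /\ x = a%:F / b%:F.
Proof.
exists \n_(repr x), \d_(repr x); split; first exact: denom_ratioP.
exact: frac_numden.
Qed.

Lemma poly_atV_frac (x : ratfun F) :
  exists a b, b != 0 /\ x = poly_atV a / poly_atV b.
Proof.
have Xp : poly_atV 'X != 0 by rewrite poly_atVX invr_eq0 X_neq0.
(* A polynomial in z is a polynomial in 1/z divided by a power of 1/z. *)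
have poly_frac (p : {poly F}) :
    exists q k, p%:F = poly_atV q / poly_atV 'X ^+ k.
  elim/poly_ind: p => [|p c [q [k pE]]].
    by exists 0, 0%N; rewrite !rmorph0 mul0r.
  exists (q + c%:P * 'X^(k.+1)), k.+1.
  rewrite tofracD tofracM pE rmorphD rmorphM poly_atVC rmorphXn mulrDl.
  rewrite mulfK ?expf_neq0 //.
  by rewrite exprS invfM [_^-1 * (_ ^+ _)^-1]mulrC mulrA poly_atVX invrK.
have [a [b [b0 ->]]] := tofrac_frac x.
have [a' [k ->]] := poly_frac a; have [b' [l bE]] := poly_frac b.
have b'0 : b' != 0.
  apply: contraNneq b0 => b'0; move/eqP: bE.
  by rewrite b'0 rmorph0 mul0r tofrac_eq0.
exists (a' * 'X^l), (b' * 'X^k); split.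
  by rewrite mulf_neq0 // expf_neq0 // polyX_eq0.
rewrite bE !rmorphM !rmorphXn invf_div mulf_div.
by rewrite [poly_atV b' * _]mulrC.
Qed.

End Laurent.

(** Applying T to a monic equation of u moves its coefficients by t and keeps it monic. *)
Lemma integral_conjugate (R E : nzRingType) (psi : {rmorphism R -> E})
    (T : {rmorphism E -> E}) (t : {rmorphism R -> R}) u :
  (forall a, T (psi a) = psi (t a)) ->
  integralOver psi u -> integralOver psi (T u).
Proof.
move=> Tpsi [Q Q1 Qu]; exists (map_poly t Q); first exact: monic_map.
rewrite -map_poly_comp (eq_map_poly (g := T \o psi)).
  by rewrite map_poly_comp rmorph_root.
by move=> a /=; rewrite Tpsi.
Qed.

Lemma integral_sum (R E : comNzRingType) (psi : {rmorphism R -> E}) (I : Type)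
    (r : seq I) (P : pred I) (u : I -> E) :
  (forall i, P i -> integralOver psi (u i)) ->
  integralOver psi (\sum_(i <- r | P i) u i).
Proof.
by move=> iu; apply: big_ind => //; [exact: integral0 | exact: integral_add].
Qed.

Section Integrality.
Variable F : fieldType.
Implicit Types (g : powser F) (x : F).

Lemma twist_laurent x : x != 0 ->
  exists T : {rmorphism laurent F -> laurent F},
    forall g, T g%:F = (twist x g)%:F.
Proof.
move=> x0; pose tw := (@FracField.tofrac (powser F) \o twist x)%FUN.
have tw_inj : injective tw.
  by move=> f g /= /eqP; rewrite tofrac_eq => /eqP /(twist_inj x0).
pose T : {rmorphism laurent F -> laurent F} :=
  HB.pack (fraclift tw)
    (GRing.isZmodMorphism.Build _ _ _ (fraclift_zmod tw_inj))
    (GRing.isMonoidMorphism.Build _ _ _ (fraclift_monoid tw_inj)).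
by exists T => g; rewrite [LHS](fraclift_tofrac tw_inj).
Qed.

Lemma integral_twist x g : x != 0 ->
  integralOver (@laurent_of_poly F) g%:F ->
  integralOver (@laurent_of_poly F) (twist x g)%:F.
Proof.
move=> x0; have [T TE] := twist_laurent x0; rewrite -TE.
apply: (@integral_conjugate _ _ _ _ (comp_poly (x *: 'X))) => p.
by rewrite [LHS]TE twist_poly.
Qed.

Lemma integral_inv_twist x N g : x != 0 ->
  integralOver (@laurent_of_polyV F) (g%:F / laurent_of_poly F 'X ^+ N) ->
  integralOver (@laurent_of_polyV F)
    ((twist x g)%:F / laurent_of_poly F 'X ^+ N).
Proof.
move=> x0; have [T TE] := twist_laurent x0.
have lpC := @laurent_of_polyVC F.
have TC c : T (laurent_of_poly F c%:P) = laurent_of_poly F c%:P.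
  by rewrite [LHS]TE twist_poly comp_polyC.
have TX : T (laurent_of_poly F 'X) =
    laurent_of_poly F x%:P * laurent_of_poly F 'X.
  by rewrite [LHS]TE twist_poly comp_polyX -mul_polyC -rmorphM.
have lpX := laurent_of_polyVX F.
have lpx : laurent_of_poly F x%:P != 0.
  by rewrite laurent_of_poly_emb fmorph_eq0 tofrac_eq0 polyC_eq0.
have lpV : (laurent_of_poly F x%:P)^-1 = laurent_of_polyV F (x^-1)%:P.
  apply: (mulfI lpx); rewrite divff // lpC -rmorphM -polyCM divff //.
  by rewrite !rmorph1.
(* The twist sends 1/z to x^-1 / z, so it preserves F[1/z]. *)
have Tinv p : T (laurent_of_polyV F p) =
    laurent_of_polyV F (comp_poly (x^-1 *: 'X) p).
  elim/poly_ind: p => [|p c IHp]; first by rewrite !rmorph0.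
  rewrite comp_polyD comp_polyM comp_polyC comp_polyX.
  rewrite !(rmorphD (laurent_of_polyV F)) !(rmorphM (laurent_of_polyV F)).
  rewrite (rmorphD T) (rmorphM T) IHp.
  by rewrite lpC TC lpX fmorphV TX -mul_polyC rmorphM lpX invfM lpV.
move=> /(integral_conjugate Tinv); rewrite fmorph_div rmorphXn TE TX => ig.
(* The twist also turned the denominator z^N into (x z)^N; the constant x^N, which is integral,
   compensates for this. *)
have -> : (twist x g)%:F / laurent_of_poly F 'X ^+ N =
    laurent_of_polyV F (x%:P ^+ N) *
    ((twist x g)%:F / (laurent_of_poly F x%:P * laurent_of_poly F 'X) ^+ N).
  rewrite rmorphXn lpC exprMn invfM mulrCA [_ * (_^-1 * _)]mulrA.
  rewrite divff ?mul1r //.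
  by rewrite expf_neq0.
apply: integral_mul ig; exact: (integral_id (laurent_of_polyV F)).
Qed.

Lemma integral_residue_part m e g (z : F) : (e < m)%N -> m.-primitive_root z ->
  integralOver (@laurent_of_poly F) g%:F ->
  integralOver (@laurent_of_poly F) (residue_part m e g)%:F.
Proof.
move=> em z_prim ig; rewrite (residue_part_twist g em z_prim) rmorph_sum.
apply: integral_sum => k _; rewrite rmorphM; apply: integral_mul.
  exact: (integral_id (laurent_of_poly F)).
apply: integral_twist => //.
by rewrite expf_neq0 // (primitive_root_neq0 z_prim).
Qed.

Lemma integral_inv_residue_part m e N g (z : F) :
  (e < m)%N -> m.-primitive_root z ->
  integralOver (@laurent_of_polyV F) (g%:F / laurent_of_poly F 'X ^+ N) ->
  integralOver (@laurent_of_polyV F)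
    ((residue_part m e g)%:F / laurent_of_poly F 'X ^+ N).
Proof.
move=> em z_prim ig; rewrite (residue_part_twist g em z_prim) rmorph_sum.
rewrite mulr_suml; apply: integral_sum => k _; rewrite rmorphM -mulrA.
apply: integral_mul.
  set c := _ * _.
  rewrite -[X in integralOver _ X]/(laurent_of_poly F c%:P).
  rewrite -laurent_of_polyVC.
  exact: (integral_id (laurent_of_polyV F)).
apply: integral_inv_twist => //.
by rewrite expf_neq0 // (primitive_root_neq0 z_prim).
Qed.
End Integrality.

(** * Minimal polynomials and the order of vanishing at 0 *)

Lemma minimal_polynomial (K E : fieldType) (emb : {rmorphism K -> E}) u P :
  P != 0 -> root (map_poly emb P) u ->
  exists mu, [/\ mu \is monic, root (map_poly emb mu) u, (size mu <= size P)%N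
    & forall q, root (map_poly emb q) u -> mu %| q].
Proof.
move=> P0 Pu.
have exn : exists n, `[< exists q : {poly K},
    [/\ size q = n, q != 0 & root (map_poly emb q) u] >].
  by exists (size P); apply/asboolP; exists P.
case: (ex_minnP exn) => n /asboolP[q [<- q0 qu]] min_q.
have lq0 : (lead_coef q)^-1 != 0 by rewrite invr_eq0 lead_coef_eq0.
pose mu := (lead_coef q)^-1 *: q.
have muu : root (map_poly emb mu) u.
  by rewrite map_polyZ rootE hornerZ (rootP qu) mulr0.
exists mu; split=> //.
- by rewrite monicE lead_coefZ mulVf // lead_coef_eq0.
- by rewrite size_scale //; apply: min_q; apply/asboolP; exists P.
move=> r ru; rewrite /mu dvdpZl //; apply: contraTT isT => /negbTE nqr.
have r0 : r %% q != 0 by rewrite -/(dvdp q r) nqr.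
have := ltn_modpN0 r q0; rewrite ltnNge; case/negP; apply: min_q.
apply/asboolP; exists (r %% q); split=> //.
rewrite [map_poly _ _](_ : _ =
  map_poly emb r - map_poly emb (r %/ q) * map_poly emb q).
  by rewrite rootE hornerD hornerN hornerM (rootP ru) (rootP qu) mulr0 subr0.
by rewrite [in X in _ = X - _](divp_eq r q) rmorphD rmorphM /= addrC addKr.
Qed.

(** If [mu] is the minimal polynomial of h, then [mu'] is that of h / c. The last clause carries the
    divisibility property over. *)
Lemma dilate_polynomial (K : fieldType) (c : K) (mu : {poly K}) :
  c != 0 -> mu \is monic ->
  let mu' := c ^- (size mu).-1 *: (mu \Po (c *: 'X)) in
  [/\ mu' \is monic, mu'`_0 = c ^- (size mu).-1 * mu`_0
    & forall Q, mu %| Q \Po (c^-1 *: 'X) -> mu' %| Q].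
Proof.
move=> c0 mu1 mu'; have cs0 : c ^+ (size mu).-1 != 0 by rewrite expf_neq0.
split=> [||Q muQ].
- rewrite monicE lead_coefZ lead_coef_comp ?size_scale ?size_polyX //.
  by rewrite (monicP mu1) mul1r lead_coefZ lead_coefX mulr1 mulVf.
- rewrite coefZ -horner_coef0 horner_comp hornerZ hornerX mulr0.
  by rewrite horner_coef0.
have -> : Q = Q \Po (c^-1 *: 'X) \Po (c *: 'X).
  rewrite -comp_polyA comp_polyZ comp_polyX scalerA mulVf // scale1r.
  by rewrite comp_polyXr.
by rewrite dvdpZl ?invr_eq0 //; apply: dvdp_comp_poly.
Qed.

Section TwoIntegralities.
Variables (F : closedFieldType) (K E : fieldType) (emb : {rmorphism K -> E}).
Variables phi psi : {rmorphism {poly F} -> K}.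
Hypotheses (phi_inj : injective phi) (psi_inj : injective psi).
Hypothesis phi_frac : forall x, exists a b, b != 0 /\ x = phi a / phi b.
Hypothesis psi_frac : forall x, exists a b, b != 0 /\ x = psi a / psi b.

(** By Gauss's lemma over [phi] the minimal polynomial of h has coefficients in F[z], and over [psi]
    so does that of h / c. Their constant coefficients differ by the factor c^s, where s is the
    common degree. *)
Lemma integral_minimal_polynomial (h : E) (c : K) (P : {poly K}) (m : nat) :
  h != 0 -> c != 0 -> P != 0 -> (size P <= m.+1)%N ->
  root (map_poly emb P) h ->
  integralOver (emb \o phi) h -> integralOver (emb \o psi) (h / emb c) ->
  exists (M : {poly {poly F}}) (e : {poly F}) (s : nat),
    [/\ root (map_poly (emb \o phi) M) h, M`_0 != 0, (s <= m)%N
      & phi M`_0 = c ^+ s * psi e].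
Proof.
move=> h0 c0 P0 sP Ph [Q Q1 Qh] [Q' Q'1 Q'h].
have [mu [mu1 muh smu min_mu]] := minimal_polynomial P0 Ph.
(* Otherwise X divides [mu], and as h is nonzero the cofactor would be a smaller polynomial
   vanishing at h. *)
have mu00 : mu`_0 != 0.
  apply/eqP => mu00; have /factor_theorem[nu muE] : root mu 0.
    by rewrite rootE horner_coef0 mu00.
  rewrite subr0 in muE.
  have nu0 : nu != 0.
    by apply: contraTneq (monic_neq0 mu1) => nu0; rewrite muE nu0 mul0r eqxx.
  have : mu %| nu.
    apply: min_mu; move: muh; rewrite muE rmorphM /= map_polyX rootM rootX.
    by rewrite (negbTE h0) orbF.
  by move/(dvdp_leq nu0); rewrite muE size_mulX // ltnn.
have [M ME] : exists M, mu = map_poly phi M.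
  have /dvdpP[nu] : mu %| map_poly phi Q.
    by apply: min_mu; rewrite -map_poly_comp.
  rewrite mulrC => /esym; exact: monic_factor_integral.
have [mu'1 mu'0 mu'_dvd] := dilate_polynomial c0 mu1.
have [M' M'E] : exists M',
    c ^- (size mu).-1 *: (mu \Po (c *: 'X)) = map_poly psi M'.
  have /mu'_dvd/dvdpP[nu] : mu %| map_poly psi Q' \Po (c^-1 *: 'X).
    apply: min_mu; rewrite map_comp_poly map_polyZ map_polyX -map_poly_comp.
    by rewrite rootE horner_comp hornerZ hornerX fmorphV mulrC.
  rewrite mulrC => /esym; exact: monic_factor_integral.
exists M, M'`_0, (size mu).-1; split.
- by move: muh; rewrite ME -map_poly_comp.
- by apply: contraNneq mu00 => M0; rewrite ME coef_map /= M0 rmorph0.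
- by rewrite -ltnS prednK ?(leq_trans smu) // size_poly_gt0 monic_neq0.
rewrite -!coef_map -M'E mu'0 mulrA divff ?mul1r -?ME //.
by rewrite expf_neq0.
Qed.
End TwoIntegralities.

Section OrderBound.
Variables (F : closedFieldType).

(** With c = z^N the constant coefficient is a polynomial a in z equal to z^(N s) e(1/z), so its
    degree is at most N s. *)
Lemma order_bound (h : powser F) (N m : nat) (P : {poly ratfun F}) :
  h != 0 -> P != 0 -> (size P <= m.+1)%N ->
  root (map_poly (@laurent_of_ratfun F) P) h%:F ->
  integralOver (laurent_of_poly F) h%:F ->
  integralOver (laurent_of_polyV F) (h%:F / laurent_of_poly F 'X ^+ N) ->
  exists a : {poly F}, [/\ a != 0, (size a <= (N * m).+1)%N
    & exists u, powser_of_poly a = h * u].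
Proof.
move=> h0 P0 sP Ph Qh Q'h.
have hF0 : h%:F != 0 :> laurent F by rewrite tofrac_eq0.
have c0 : ('X : {poly F})%:F ^+ N != 0 :> ratfun F.
  exact: expf_neq0 (X_neq0 F).
have lpE : laurent_of_poly F =
    (@laurent_of_ratfun F \o @FracField.tofrac {poly F})%FUN :> (_ -> _).
  by apply/funext => p; rewrite laurent_of_poly_emb.
have Q'h' : integralOver (@laurent_of_ratfun F \o poly_atV F)
    (h%:F / laurent_of_ratfun ('X%:F ^+ N)).
  by move: Q'h; rewrite rmorphXn laurent_of_poly_emb.
have Qh' : integralOver (@laurent_of_ratfun F \o @FracField.tofrac {poly F})
    h%:F.
  rewrite -lpE; exact: Qh.
have [M [e [s [Mh M0 sm aE]]]] := integral_minimal_polynomial (@tofrac_inj F)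
  (@poly_atV_inj F) (@tofrac_frac F) (@poly_atV_frac F)
  hF0 c0 P0 sP Ph Qh' Q'h'.
exists M`_0; split=> //.
- set a := M`_0 in M0 aE *.
  have e0 : e != 0.
    apply: contraNneq M0 => e0; rewrite -tofrac_eq0 [_%:F]aE e0 rmorph0 mulr0.
    exact: eqxx.
  (* Multiplying by z^(deg e) clears the negative powers, and degrees can be compared in F[z]. *)
  have : a * 'X^((size e).-1) = 'X^(N * s) * revpoly e.
    apply: (@tofrac_inj F); rewrite !tofracM !tofracXn -poly_atVE [a%:F]aE.
    by rewrite -mulrA exprM.
  move/(congr1 (fun p : {poly F} => size p)).
  rewrite size_mulXn // mulrC size_mulXn; last first.
    apply: contraNneq e0 => r0; apply: contraTT isT => e0.
    move: (revpoly0 e0); rewrite r0 coef0 => /esym/eqP.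
    by rewrite lead_coef_eq0 (negbTE e0).
  have se : size e = (size e).-1.+1 by rewrite prednK // size_poly_gt0.
  move=> sizes.
  have : ((size e).-1 + size a <= (size e).-1 + (N * s).+1)%N.
    by rewrite sizes addnS addnC -addSn leq_add2r -se size_revpoly.
  by rewrite leq_add2l => /leq_trans; apply; rewrite ltnS leq_mul2l sm orbT.
have hroot : root (map_poly (@powser_of_poly F) M) h.
  move: Mh; rewrite -lpE [map_poly _ _]map_poly_comp.
  by rewrite /root horner_map /= tofrac_eq0.
(* Isolating the constant term in M(h) = 0 shows that h divides it. The sum is one term too long,
   with a zero coefficient, which avoids splitting on [size M]. *)
exists (- \sum_(i < size M) powser_of_poly M`_i.+1 * h ^+ i).
move/rootP: hroot; rewrite (@horner_coef_wide _ (size M).+1); last first.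
  exact: leq_trans (size_poly _ _) _.
rewrite big_ord_recl expr0 mulr1 coef_map /= => /eqP.
rewrite addr_eq0 => /eqP ->; rewrite mulrN mulr_sumr; congr (- _).
by apply: eq_bigr => i _; rewrite coef_map /= exprS mulrCA.
Qed.

End OrderBound.

(** * Algebraic Mahler functions over a closed field *)

(** As n is invertible, X^n - 1 is separable and has n distinct roots, among which a primitive one
    exists. *)
Lemma closed_prim_root (F : closedFieldType) n :
  n%:R != 0 :> F -> exists z : F, n.-primitive_root z.
Proof.
move=> n0; have n_gt0 : (0 < n)%N by rewrite lt0n; apply: contraNneq n0 => ->.
have [rs rsE] := closed_field_poly_normal ('X^n - 1 : {poly F}).
rewrite lead_coefXnsubC // scale1r in rsE.
have /hasP[z _ zP] : has n.-primitive_root rs; last by exists z.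
apply: cyclic.has_prim_root => //.
- apply/allP => z zrs; rewrite /= unity_rootE -subr_eq0.
  have : root (\prod_(x <- rs) ('X - x%:P)) z by rewrite root_prod_XsubC.
  by rewrite -rsE rootE !hornerE.
- by rewrite -separable_prod_XsubC -rsE cyclotomic.separable_Xn_sub_1.
by rewrite -ltnS -(size_prod_XsubC _ id) -rsE size_XnsubC.
Qed.

(** Each factor z - x divides z^d - x^d. This replaces a multiplier by a polynomial in z^d, over
    which sections are linear. *)
Lemma dvdp_comp_Xn (F : closedFieldType) (d : nat) (B : {poly F}) :
  B != 0 -> exists2 B' : {poly F}, B' != 0 & B %| B' \Po 'X^d.
Proof.
move=> B0; have [rs ->] := closed_field_poly_normal B.
exists (\prod_(x <- rs) ('X - (x ^+ d)%:P)).
  by rewrite monic_neq0 // monic_prod_XsubC.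
rewrite dvdpZl ?lead_coef_eq0 //.
elim: rs => [|x rs IHrs]; first by rewrite !big_nil dvd1p.
rewrite !big_cons comp_polyM; apply: dvdp_mul => //.
rewrite comp_polyB comp_polyX comp_polyC dvdp_XsubCl.
by rewrite rootE !hornerE subrr.
Qed.

Section MahlerSpace.
Variables (F : closedFieldType) (d n : nat) (f : powser F).
Hypothesis d_gt0 : (0 < d)%N.
Local Notation pp := (@powser_of_poly F).

(** The power series in the F(z)-span of the f(z^(d^j)), j <= n, with a common denominator b
    cleared. *)
Definition mahler_span (g : powser F) :=
  exists2 b : {poly F}, b != 0 & exists a : nat -> {poly F},
    pp b * g = \sum_(j < n.+1) pp (a j) * powser_subst (d ^ j) f.

Lemma mahler_span_mul (c : {poly F}) : mahler_span (pp c * f).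
Proof.
exists 1; first exact: oner_neq0.
exists (fun j => if j == 0 then c else 0).
rewrite rmorph1 mul1r big_ord_recl /= expn0 powser_subst1 big1 ?addr0 //.
by move=> i _; rewrite rmorph0 mul0r.
Qed.

Variable P : nat -> {poly F}.
Hypothesis P0 : P 0%N != 0.
Hypothesis mahler_eq :
  \sum_(j < n.+1) pp (P j) * powser_subst (d ^ j) f = 0.

(* As P 0 <> 0, the equation rewrites f through the f(z^(d^j)) with j >= 1,
   whose sections are again in the span. *)
Lemma mahler_span_section e g : (e < d)%N ->
  mahler_span g -> mahler_span (powser_section d e g).
Proof.
move=> ed [b b0 [a gE]].
have [B B0 /dvdpP[c cB]] := dvdp_comp_Xn d (mulf_neq0 P0 b0).
(* The coefficients left after eliminating f(z) between b g and the Mahler equation; the index is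
   shifted because only j >= 1 remains. *)
pose a1 j := c * (P 0%N * a j.+1 - a 0%N * P j.+1).
have BgE : pp (B \Po 'X^d) * g =
    \sum_(j < n) pp (a1 j) * powser_subst d (powser_subst (d ^ j) f).
  have -> : pp (B \Po 'X^d) * g = pp c * (pp (P 0%N) * (pp b * g)).
    by rewrite cB !rmorphM /= !mulrA.
  rewrite gE big_ord_recl mulrDr.
  have -> : pp (P 0%N) * (pp (a 0%N) * powser_subst (d ^ 0) f) =
      - pp (a 0%N) * \sum_(j < n) pp (P j.+1) * powser_subst (d ^ j.+1) f.
    move/eqP: mahler_eq; rewrite big_ord_recl addr_eq0 => /eqP fE.
    by rewrite mulrCA [pp (P 0%N) * _]fE mulrN mulNr.
  rewrite !mulr_sumr -big_split mulr_sumr; apply: eq_bigr => j _ /=.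
  rewrite powser_substA ?expn_gt0 ?d_gt0 // -expnS /a1.
  rewrite rmorphM rmorphB !rmorphM /=.
  ring.
exists B => //.
(* Each section lowers the index j by one, so the last coefficient is zero. *)
exists (fun j => if (j < n)%N then poly_section d e (a1 j) else 0).
rewrite big_ord_recr /= ltnn rmorph0 mul0r addr0.
move: BgE => /(congr1 (powser_section d e)).
rewrite -powser_subst_poly // mulrC powser_sectionM // mulrC => ->.
rewrite raddf_sum; apply: eq_bigr => j _.
by rewrite ltn_ord [LHS]powser_sectionM // powser_section_poly.
Qed.

Lemma mahler_span_sections k e g : (e < d ^ k)%N ->
  mahler_span g -> mahler_span (powser_section (d ^ k) e g).
Proof.
elim: k e g => [|k IHk] e g ek gM.
  move: ek; rewrite expn0 ltnS leqn0 => /eqP ->.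
  by congr mahler_span: gM; apply: powserP => i; rewrite /= mul1n addn0.
(* Peel off the lowest digit of e in base d. *)
have -> : powser_section (d ^ k.+1) e g =
    powser_section (d ^ k) (e %/ d) (powser_section d (e %% d) g).
  apply: powserP => i /=; congr (g _).
  by rewrite {1}(divn_eq e d) expnS mulnDr mulnA addnA [(_ %/ _ * _)%N]mulnC.
apply: IHk; last exact/mahler_span_section/gM/ltn_pmod.
by rewrite ltn_divLR // -expnSr.
Qed.

End MahlerSpace.

Section BoundedDegree.
Variable F : fieldType.
Local Notation pp := (@powser_of_poly F).

(** Algebraicity over F(z) with denominators cleared: such equations can be moved by ring maps out
    of F[z], such as z |-> z^m or a base change. *)
Definition algebraic_powser (f : powser F) :=
  exists2 P : {poly {poly F}}, P != 0 & root (map_poly pp P) f.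

Lemma root_laurent (P : {poly {poly F}}) (f : powser F) :
  root (map_poly (@laurent_of_ratfun F)
          (map_poly (@FracField.tofrac {poly F}) P)) f%:F =
  root (map_poly pp P) f.
Proof.
rewrite -map_poly_comp (eq_map_poly (@laurent_of_ratfun_poly F)).
by rewrite map_poly_comp /root horner_map /= tofrac_eq0.
Qed.

Lemma ratfun_root_poly (P : {poly ratfun F}) (f : powser F) :
  P != 0 -> root (map_poly (@laurent_of_ratfun F) P) f%:F ->
  exists Q : {poly {poly F}},
    [/\ Q != 0, size Q = size P & root (map_poly pp Q) f].
Proof.
move=> P0 Pf.
have [b b0 [Q QE]] := clear_denominators (@tofrac_inj F) (@tofrac_frac F) P.
have bF0 : b%:F != 0 :> ratfun F by rewrite tofrac_eq0.
exists Q; split.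
- by rewrite -(map_inj_poly_eq0 _ (@tofrac_inj F)) QE scaler_eq0 negb_or bF0.
- by rewrite -(size_map_inj_poly (@tofrac_inj F) (rmorph0 _)) QE size_scale.
rewrite -root_laurent QE map_polyZ /root hornerZ (rootP Pf) mulr0.
exact: eqxx.
Qed.

Lemma algebraic_powserP (f : powser F) :
  algebraic_powser f <-> algebraicOver (@laurent_of_ratfun F) f%:F.
Proof.
split=> [[P P0 Pf]|[P P0 Pf]].
  exists (map_poly (@FracField.tofrac {poly F}) P).
    by rewrite (map_inj_poly_eq0 _ (@tofrac_inj F)).
  by rewrite root_laurent.
by have [Q [Q0 _ Qf]] := ratfun_root_poly P0 Pf; exists Q.
Qed.

Lemma comp_Xn_inj m : (0 < m)%N -> injective (comp_poly ('X^m : {poly F})).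
Proof.
move=> m0 p q pq; apply: (@powser_of_poly_inj F).
have secE r := @powser_section_subst F m 0 (pp r) m0.
by rewrite -[LHS]secE -[RHS]secE !powser_subst_poly // pq.
Qed.

Lemma algebraic_powser_subst m (f : powser F) : (0 < m)%N ->
  algebraic_powser f -> algebraic_powser (powser_subst m f).
Proof.
move=> m0 [P P0 Pf]; exists (map_poly (comp_poly 'X^m) P).
  by rewrite map_inj_poly_eq0 //; apply: comp_Xn_inj.
exact: root_subst.
Qed.

End BoundedDegree.

Lemma root_dilate (K E : fieldType) (emb : {rmorphism K -> E}) (c : K) (u : E)
    (P : {poly K}) :
  c != 0 -> root (map_poly emb P) u ->
  exists P' : {poly K}, size P' = size P /\ root (map_poly emb P') (emb c * u).
Proof.
move=> c0 Pu; exists (P \Po (c^-1 *: 'X)); split.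
  by rewrite size_comp_poly2 // size_scale ?invr_eq0 // size_polyX.
rewrite map_comp_poly map_polyZ map_polyX rootE horner_comp hornerZ hornerX.
by rewrite mulrA -rmorphM mulVf // rmorph1 mul1r.
Qed.

(* If u is a root of X^s + a_1 X^(s-1) + ... + a_s, then u / c is a root of
   X^s + (a_1 / c) X^(s-1) + ... + a_s / c^s. *)
Lemma integral_dilate (R : comNzRingType) (E : fieldType)
    (psi : {rmorphism R -> E}) (mu : {poly E}) (u c : E) :
  mu \is monic -> root mu u -> c != 0 ->
  (forall k j, (k + j).+1 = (size mu).-1 ->
    integralOver psi (mu`_j / c ^+ k.+1)) ->
  integralOver psi (u / c).
Proof.
move=> mu1 muu c0 mu_int; have [mu'1 _ _] := dilate_polynomial c0 mu1.
apply: (integral_root_monic mu'1).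
  by rewrite rootE hornerZ horner_comp hornerZ hornerX mulrCA divff // mulr1
    (rootP muu) mulr0.
apply/integral_poly => j; rewrite coefZ.
(* The coefficient is read off from the power series identity for [twist]. *)
have -> : (mu \Po (c *: 'X))`_j = c ^+ j * mu`_j.
  by have := congr1 (fun g => pcoef g j) (twist_poly c mu).
have [lt_j|] := ltnP j (size mu).-1.
  have := mu_int ((size mu).-1 - j).-1 j.
  rewrite prednK ?subn_gt0 // -addSn prednK ?subn_gt0 // subnK 1?ltnW //.
  move=> /(_ erefl); congr integralOver.
  rewrite -{2}(subnK (ltnW lt_j)) exprD invfM -mulrA mulrC.
  by rewrite mulKf // expf_neq0.
rewrite leq_eqVlt => /orP[/eqP <-|lt_j].
  rewrite mulrA mulVf ?expf_neq0 // mul1r.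
  by rewrite -[_`__]/(lead_coef mu) (monicP mu1); apply: integral1.
rewrite [mu`_j]nth_default ?mulr0; first exact: integral0.
by case: (size mu) lt_j.
Qed.

Section Core.
Variable F : closedFieldType.
Local Notation pp := (@powser_of_poly F).

(** For deg p <= k the quotient p / z^k already lies in F[1/z]. *)
Lemma integral_polyV_quotient (p : {poly F}) k : (size p <= k.+1)%N ->
  integralOver (laurent_of_polyV F)
    (laurent_of_poly F p / laurent_of_poly F 'X ^+ k).
Proof.
move=> sp; suff [q ->] : exists q,
    laurent_of_poly F p / laurent_of_poly F 'X ^+ k = laurent_of_polyV F q.
  exact: (integral_id (laurent_of_polyV F)).
have X0 : laurent_of_poly F 'X != 0.
  rewrite laurent_of_poly_emb fmorph_eq0; exact: X_neq0.
have quotientD (E : fieldType) (x a c : E) i : x != 0 ->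
    (a * x + c) / x ^+ i.+1 = a / x ^+ i + c * x^-1 ^+ i.+1.
  by move=> x0; rewrite exprVn mulrDl exprS invfM mulrA mulfK.
elim: k p sp => [|k IHk] p sp.
  have [c ->] : exists c, p = c%:P by exists p`_0; apply: size1_polyC.
  by exists c%:P; rewrite laurent_of_polyVC expr0 divr1.
elim/poly_ind: p sp => [_|p c _]; first by exists 0; rewrite !rmorph0 mul0r.
rewrite size_MXaddC => sp.
have [|q qE] := IHk p.
  by move: sp; case: ifP => [/andP[/eqP -> _] _|_]; rewrite ?size_poly0.
exists (q + c%:P * 'X^(k.+1)).
rewrite (rmorphD (laurent_of_poly F)) (rmorphM (laurent_of_poly F)).
rewrite (quotientD _ _ _ _ _ X0) qE (rmorphD (laurent_of_polyV F)).
rewrite (rmorphM (laurent_of_polyV F)) (rmorphXn (laurent_of_polyV F)).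
by rewrite laurent_of_polyVC laurent_of_polyVX.
Qed.

(** N bounds the sizes of all coefficients of Q, so each coefficient divided by a positive power of
    z^N lies in F[1/z], and dividing the root by z^N keeps the equation integral. *)
Lemma integral_at_infinity (g : powser F) (Q : {poly {poly F}}) :
  Q \is monic -> root (map_poly pp Q) g ->
  exists N,
    integralOver (laurent_of_polyV F) (g%:F / laurent_of_poly F 'X ^+ N).
Proof.
move=> Q1 Qg; pose N := (\max_(i < size Q) size (Q`_i)%R)%N; exists N.
have sizeN i : (size (Q`_i)%R <= N)%N.
  have [lti|?] := ltnP i (size Q); last by rewrite nth_default ?size_poly0.
  exact: (@leq_bigmax _ (fun i : 'I_(size Q) => size Q`_i) (Ordinal lti)).
have QgF : root (map_poly (laurent_of_poly F) Q) g%:F.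
  by rewrite map_poly_comp /root horner_map /= tofrac_eq0.
apply: (integral_dilate (monic_map _ Q1) QgF).
  apply: expf_neq0; rewrite laurent_of_poly_emb fmorph_eq0; exact: X_neq0.
move=> k j _; rewrite coef_map -exprM; apply: integral_polyV_quotient.
by rewrite (leq_trans (sizeN j)) // mulnS -addnS leq_addr.
Qed.

Lemma mahler_span_degree d n (f : powser F) : (0 < d)%N -> algebraic_powser f ->
  exists m, forall g, mahler_span d n f g ->
    exists Q : {poly {poly F}},
      [/\ Q != 0, (size Q <= m)%N & root (map_poly pp Q) g].
Proof.
move=> d0 alg_f.
pose y (j : 'I_n.+1) := (powser_subst (d ^ j) f)%:F : laurent F.
have [|m mP] := @algebraic_bounded_degree _ _ (@laurent_of_ratfun F) _ y.
  move=> j; apply/algebraic_powserP/algebraic_powser_subst => //.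
  by rewrite expn_gt0 d0.
exists m => g [b b0 [a gE]].
have [P [P0 sP Pg]] := mP (fun j : 'I_n.+1 => (a j)%:F / b%:F).
have b0' : (pp b)%:F != 0 :> laurent F.
  by rewrite -laurent_of_ratfun_poly fmorph_eq0 tofrac_eq0.
have embE j : laurent_of_ratfun ((a j)%:F / b%:F) =
    (pp (a j))%:F / (pp b)%:F :> laurent F.
  by rewrite fmorph_div /= !laurent_of_ratfun_poly.
have gE' : g%:F = \sum_(j < n.+1) laurent_of_ratfun ((a j)%:F / b%:F) * y j.
  apply: (mulfI b0'); rewrite -rmorphM gE rmorph_sum mulr_sumr.
  apply: eq_bigr => j _; rewrite embE [LHS]rmorphM mulrA.
  by rewrite [_ * (_ / _)]mulrC (divfK b0').
rewrite -gE' in Pg; have [Q [Q0 sQ Qg]] := ratfun_root_poly P0 Pg.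
by exists Q; split; rewrite ?sQ.
Qed.

(** The residue part is z^e u(z^D) with u the section: substitute z^D in an equation of u, then
    dilate by z^e. Neither operation changes the degree. *)
Lemma residue_part_root (D e : nat) (g : powser F) (Q : {poly {poly F}}) :
  (e < D)%N -> Q != 0 -> root (map_poly pp Q) (powser_section D e g) ->
  exists P : {poly ratfun F}, [/\ P != 0, (size P <= size Q)%N
    & root (map_poly (@laurent_of_ratfun F) P) (residue_part D e g)%:F].
Proof.
move=> eD Q0 Qg; have D0 : (0 < D)%N by case: D eD {Qg}.
have := root_subst D0 Qg; set Q' := map_poly _ Q => Q'g.
have c0 : ('X : {poly F})%:F ^+ e != 0 :> ratfun F.
  exact: expf_neq0 (X_neq0 F).
rewrite -root_laurent in Q'g; have [P [sP Pg]] := root_dilate c0 Q'g.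
have sQ' : size P = size Q.
  rewrite sP (size_map_inj_poly (@tofrac_inj F) (rmorph0 _)).
  by rewrite /Q' (size_map_inj_poly (comp_Xn_inj D0) (comp_poly0 _)).
exists P; split; first by rewrite -size_poly_gt0 sQ' size_poly_gt0.
  by rewrite sQ'.
congr (root _ _): Pg.
rewrite residue_part_section // [RHS]rmorphM; congr (_ * _).
by rewrite !rmorphXn /= laurent_of_ratfun_poly.
Qed.

Lemma algebraic_mahler_polynomial d n (P : nat -> {poly F}) (f : powser F)
    (c : {poly F}) (Q : {poly {poly F}}) :
  (2 <= d)%N -> d%:R != 0 :> F -> algebraic_powser f ->
  P 0%N != 0 -> \sum_(j < n.+1) pp (P j) * powser_subst (d ^ j) f = 0 ->
  Q \is monic -> root (map_poly pp Q) (pp c * f) ->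
  exists H, forall k, (H < k)%N -> (pp c * f) k = 0.
Proof.
move=> d2 dF alg_f P0 mahler_eq Q1 Qg; set g := pp c * f in Qg *.
have d0 : (0 < d)%N by exact: ltnW.
have [N gN] := integral_at_infinity Q1 Qg.
have g0 : integralOver (laurent_of_poly F) g%:F.
  by exists Q => //; rewrite map_poly_comp /root horner_map /= tofrac_eq0.
have [m mP] := mahler_span_degree n d0 alg_f.
exists (N * m)%N => k lt_k; apply/eqP; apply: contraTT isT => gk.
(* The exponent k also serves as the power of d: from k < d^k it is its own residue, so h begins
   with the term in z^k. *)
pose D := (d ^ k)%N; have kD : (k < D)%N by exact: ltn_expl.
have [|z z_prim] := @closed_prim_root F D.
  by rewrite natrX expf_neq0.
pose h := residue_part D k g.
have hk : h k = g k by rewrite /= modn_small // eqxx.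
have h_lt i : (i < k)%N -> h i = 0.
  by move=> ik; rewrite /= modn_small ?(ltn_trans ik) // ltn_eqF.
have [B [B0 sB Bs]] := mP _
  (mahler_span_sections d0 P0 mahler_eq kD (mahler_span_mul d n f c)).
have [A [A0 sA Ah]] := residue_part_root kD B0 Bs.
have h0 : h != 0.
  by apply: contraNneq gk => h0; rewrite -hk h0.
have sA' : (size A <= m.+1)%N by rewrite (leq_trans sA) // (leq_trans sB).
have [a [a0 sa [u aE]]] := order_bound h0 A0 sA' Ah
  (integral_residue_part kD z_prim g0) (integral_inv_residue_part kD z_prim gN).
(* The nonzero polynomial a is a multiple of h, so its coefficients below z^k vanish; but its degree
   is at most N m < k. *)
case/eqP: a0; apply/polyP => i; rewrite coef0.
have [ik|ki] := ltnP i k; last first.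
  by rewrite nth_default // (leq_trans sa) // (leq_trans lt_k).
have -> : a`_i = (h * u) i by rewrite -aE.
rewrite pcoefM big1 // => j _; rewrite h_lt ?mul0r //.
by rewrite (leq_trans (ltn_ord j)).
Qed.

End Core.

(** * Base change and the theorem *)

Lemma poly_section_neq0 (F : fieldType) d (p : {poly F}) :
  (0 < d)%N -> p != 0 ->
  exists2 e, (e < d)%N & poly_section d e p != 0.
Proof.
move=> d0 p0; pose k := (size p).-1.
exists (k %% d)%N; first exact: ltn_pmod.
apply: contraNneq p0 => s0; rewrite -lead_coef_eq0 -[lead_coef p]/(p`_k).
have := congr1 (fun q : powser F => q (k %/ d)%N)
  (powser_section_poly (k %% d) p d0).
by rewrite s0 /= coef0 mulnC -divn_eq => ->.
Qed.

(** While the coefficient of f(z) vanishes, a section turns each f(z^(d^(j+1))) into f(z^(d^j)).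
    Choosing a residue at which [P i] has a nonzero section keeps the equation nontrivial as i and n
    drop by one. *)
Lemma mahler_normal (F : fieldType) d n (P : nat -> {poly F}) (f : powser F) i :
  (0 < d)%N -> (i <= n)%N -> P i != 0 ->
  \sum_(j < n.+1) powser_of_poly (P j) * powser_subst (d ^ j) f = 0 ->
  exists m (Q : nat -> {poly F}), Q 0%N != 0 /\
    \sum_(j < m.+1) powser_of_poly (Q j) * powser_subst (d ^ j) f = 0.
Proof.
move=> d0; elim: n i P => [|n IHn] i P.
  by rewrite leqn0 => /eqP -> P0 ?; exists 0%N, P.
move=> le_i Pi rel; have [P0|] := eqVneq (P 0%N) 0; last by exists n.+1, P.
case: i => [|i] in le_i Pi; first by rewrite P0 eqxx in Pi.
have [e ed se] := poly_section_neq0 d0 Pi.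
apply: (IHn i (fun j => poly_section d e (P j.+1))) => //.
move/(congr1 (powser_section d e)): rel.
rewrite big_ord_recl P0 rmorph0 mul0r add0r.
rewrite !raddf_sum raddf0 => {2}<-; apply: eq_bigr => j _.
rewrite expnS -powser_substA ?expn_gt0 ?d0 // [RHS]powser_sectionM //.
by rewrite powser_section_poly.
Qed.

Section BaseChange.
Variables (L A : fieldType) (theta : {rmorphism L -> A}).

Definition map_powser (f : powser L) : powser A :=
  Powser (fun n => theta (f n)).

Lemma map_powser_zmod : zmod_morphism map_powser.
Proof. by move=> f g; apply: powserP => n /=; rewrite rmorphB. Qed.

Lemma map_powser_monoid : monoid_morphism map_powser.
Proof.
split=> [|f g]; apply: powserP => n /=; first by rewrite rmorph_nat.
by rewrite rmorph_sum; apply: eq_bigr => i _; rewrite rmorphM.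
Qed.

HB.instance Definition _ := GRing.isZmodMorphism.Build
  (powser L) (powser A) map_powser map_powser_zmod.
HB.instance Definition _ := GRing.isMonoidMorphism.Build
  (powser L) (powser A) map_powser map_powser_monoid.

Lemma map_powser_poly (p : {poly L}) :
  map_powser (powser_of_poly p) = powser_of_poly (map_poly theta p).
Proof. by apply: powserP => n /=; rewrite coef_map. Qed.

Lemma map_powser_subst m (f : powser L) :
  map_powser (powser_subst m f) = powser_subst m (map_powser f).
Proof. by apply: powserP => n /=; case: ifP => // _; rewrite rmorph0. Qed.

Lemma map_powser_root (P : {poly {poly L}}) (f : powser L) :
  root (map_poly (@powser_of_poly L) P) f ->
  root (map_poly (@powser_of_poly A) (map_poly (map_poly theta) P))
    (map_powser f).
Proof.
move=> Pf; rewrite -map_poly_comp -(eq_map_poly map_powser_poly).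
by rewrite map_poly_comp rmorph_root.
Qed.

End BaseChange.

(** With deg P = s + 1 and leading coefficient c, multiplying P(u) = 0 by c^s gives a monic equation
    in c u. *)
Lemma root_lead_coef_monic (R S : comNzRingType) (phi : {rmorphism R -> S})
    (P : {poly R}) u : (1 < size P)%N -> root (map_poly phi P) u ->
  exists2 Q, Q \is monic & root (map_poly phi Q) (phi (lead_coef P) * u).
Proof.
move=> sP Pu; pose s := (size P).-2; pose c := lead_coef P.
have sE : size P = s.+2 by rewrite /s; case: (size P) sP => [|[]].
pose p := \poly_(j < s.+1) (P`_j * c ^+ (s - j)).
have sp : (size p < size ('X^(s.+1) : {poly R}))%N.
  by rewrite size_polyXn ltnS size_poly.
exists ('X^(s.+1) + p); first by rewrite monicE lead_coefDl // lead_coefXn.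
rewrite rmorphD /= map_polyXn rootE hornerD hornerXn.
rewrite (@horner_coef_wide _ s.+1); last first.
  exact: leq_trans (size_poly _ _) (size_poly _ _).
have := rootP Pu; rewrite (@horner_coef_wide _ s.+2) -?sE ?size_poly //.
rewrite sE big_ord_recr /= => /(congr1 (fun v => phi c ^+ s * v)).
rewrite mulr0 mulrDr mulr_sumr => Pu0; apply/eqP; rewrite -[RHS]Pu0 addrC.
congr (_ + _).
  apply: eq_bigr => j _; rewrite !coef_map coef_poly ltn_ord /=.
  rewrite rmorphM rmorphXn.
  have -> : phi c ^+ s = phi c ^+ (s - j) * phi c ^+ j.
    by rewrite -exprD subnK // -ltnS.
  by rewrite -/c exprMn; ring.
rewrite coef_map /= -[P`_s.+1]/(P`_s.+2.-1) -sE -/(lead_coef P) -/c.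
by rewrite exprMn exprSr mulrA.
Qed.

(** The minimal polynomial of x over K splits in A, so iota(x) is the image under j of one of its
    roots. Thus iota factors through the injective map j. *)
Lemma embed_closed_field (K : fieldType) (L : fieldExtType K)
    (A : closedFieldType) (C : fieldType) (a : {rmorphism K -> A})
    (j : {rmorphism A -> C}) (iota : {rmorphism L -> C}) :
  (forall x : K, iota x%:A = j (a x)) ->
  exists theta : {rmorphism L -> A}, forall x, j (theta x) = iota x.
Proof.
move=> iotaK.
have liftP x : exists y, j y = iota x.
  have /polyOver1P[q qE] := minPolyOver 1%AS x.
  have := root_minPoly 1%AS x; rewrite qE => qx.
  have : root (map_poly j (map_poly a q)) (iota x).
    rewrite -map_poly_comp -(eq_map_poly iotaK).
    by rewrite (map_poly_comp iota (in_alg L)) rmorph_root.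
  have [rs ->] := closed_field_poly_normal (map_poly a q).
  rewrite map_polyZ rootZ; last first.
    rewrite fmorph_eq0 lead_coef_eq0 map_poly_eq0.
    apply: contraTneq (monic_minPoly 1%AS x) => q0.
    by rewrite qE q0 map_poly0 monicE lead_coef0 eq_sym oner_eq0.
  rewrite rmorph_prod /root horner_prod prodf_seq_eq0 => /hasP[y _ /=].
  rewrite rmorphB /= map_polyX map_polyC hornerXsubC subr_eq0 => /eqP ->.
  by exists y.
pose t x := projT1 (cid (liftP x)).
have tE x : j (t x) = iota x := projT2 (cid (liftP x)).
have t_zmod : zmod_morphism t.
  by move=> x y; apply: (fmorph_inj j); rewrite rmorphB !tE rmorphB.
have t_monoid : monoid_morphism t.
  split=> [|x y]; apply: (fmorph_inj j); first by rewrite tE !rmorph1.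
  by rewrite rmorphM !tE rmorphM.
pose theta : {rmorphism L -> A} := HB.pack t
  (GRing.isZmodMorphism.Build _ _ _ t_zmod)
  (GRing.isMonoidMorphism.Build _ _ _ t_monoid).
by exists theta.
Qed.

Lemma algebraic_mahler_rational (L : fieldType) (A : closedFieldType)
    (theta : {rmorphism L -> A}) d (f : powser L) :
  (2 <= d)%N -> d%:R != 0 :> L -> mahler d f -> algebraic_powser f ->
  in_ratfun f.
Proof.
move=> d2 dL [n [P Pn rel]] [Q Q0 Qf]; have d0 : (0 < d)%N by exact: ltnW.
pose P1 k := P (inord k : 'I_n.+1).
have rel1 : \sum_(j < n.+1) powser_of_poly (P1 j) * powser_subst (d ^ j) f = 0.
  by rewrite -[RHS]rel; apply: eq_bigr => j _; rewrite /P1 inord_val.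
have P1n : P1 n != 0 by congr (P _ != 0): Pn; apply: val_inj; rewrite /= inordK.
have [m [R [R0 relR]]] := mahler_normal d0 (leqnn n) P1n rel1.
have sQ : (1 < size Q)%N.
  rewrite ltnNge; apply: contraNN Q0 => /size1_polyC QE; move: Qf.
  rewrite QE map_polyC rootC /= -(rmorph0 (@powser_of_poly L)).
  by move=> /eqP/powser_of_poly_inj ->.
pose c := lead_coef Q.
have c0 : c != 0 by rewrite lead_coef_eq0.
have [M M1 Mf] := root_lead_coef_monic sQ Qf.
have theta_inj : injective (map_poly theta) by apply: map_poly_inj.
pose fA := map_powser theta f.
have fA_alg : algebraic_powser fA.
  exists (map_poly (map_poly theta) Q); last exact: map_powser_root.
  by rewrite map_inj_poly_eq0.
have relA : \sum_(j < m.+1) powser_of_poly (map_poly theta (R j)) *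
    powser_subst (d ^ j) fA = 0.
  move: relR => /(congr1 (map_powser theta)).
  rewrite rmorph0 rmorph_sum => relA; rewrite -[RHS]relA.
  apply: eq_bigr => j _; rewrite rmorphM /=.
  by rewrite map_powser_poly map_powser_subst.
have gA : map_powser theta (powser_of_poly c * f) =
    powser_of_poly (map_poly theta c) * fA.
  by rewrite rmorphM /= map_powser_poly.
have dA : d%:R != 0 :> A by rewrite -(rmorph_nat theta) fmorph_eq0.
have RA : map_poly theta (R 0%N) != 0 by rewrite map_poly_eq0.
have MA : root (map_poly (@powser_of_poly A) (map_poly (map_poly theta) M))
    (powser_of_poly (map_poly theta c) * fA).
  by rewrite -gA; apply: map_powser_root.
have [H HP] := algebraic_mahler_polynomial d2 dA fA_alg
  (P := fun k => map_poly theta (R k)) RA relA (monic_map _ M1) MA.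
(* The multiplier c is defined over L and theta is injective, so the vanishing of the high
   coefficients descends to L. *)
have [q qE] : exists q, powser_of_poly c * f = powser_of_poly q.
  exists (\poly_(k < H.+1) (powser_of_poly c * f) k); apply: powserP => k.
  rewrite [RHS]coef_poly; case: ltnP => // /HP; rewrite -gA => /eqP.
  by rewrite fmorph_eq0 => /eqP.
exists (q%:F / c%:F); rewrite fmorph_div /= !laurent_of_ratfun_poly -qE.
have cF0 : (powser_of_poly c)%:F != 0 :> laurent L.
  by rewrite -laurent_of_ratfun_poly fmorph_eq0 tofrac_eq0.
by rewrite rmorphM /= mulrAC divff // mul1r.
Qed.

Theorem theorem1p6 (R : realType) (p r : nat) (Fq : finFieldType)
    (p_prime : prime p) (card_Fq : #|Fq| = (p ^ r)%N)
    (* A is an algebraic closure of F_q((1/T)) *)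
    (A : closedFieldType) (jA : {rmorphism laurent Fq -> A})
    (A_algebraic : forall a : A, algebraicOver jA a)
    (absA : A -> R) (absA_absv : absolute_value absA)
    (absA_ext : forall x : laurent Fq, absA (jA x) = laurent_abs R x)
    (* C is its completion *)
    (C : fieldType) (absC : C -> R) (absC_absv : absolute_value absC)
    (jC : {rmorphism A -> C}) (C_completion : completion absA absC jC)
    (* L is a finite extension of K = F_q(T), embedded in C over K *)
    (L : fieldExtType (ratfun Fq)) (iota : {rmorphism L -> C})
    (iota_K : forall x : ratfun Fq,
      iota (x%:A) = jC (jA (laurentV_of_ratfun x)))
    (d : nat) (d_ge2 : (2 <= d)%N) (p_ndvd_d : ~~ (p %| d)%N)
    (f : powser L) (f_cvg : convergent_near0 absC iota f)
    (f_mahler : mahler d f) :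
  transcendental_over_ratfun f \/ in_ratfun f.
Proof.
have [f_alg|] := pselect (algebraicOver (@laurent_of_ratfun L) f%:F);
  last by left.
right; have [theta _] :=
  @embed_closed_field _ L A C (jA \o @laurentV_of_ratfun Fq)%FUN jC iota iota_K.
apply: (algebraic_mahler_rational theta d_ge2 _ f_mahler);
  last exact/algebraic_powserP.
(* L inherits characteristic p from [Fq], so d is nonzero in L exactly when p does not divide d. *)
pose e : {rmorphism Fq -> L} :=
  (in_alg L \o (@FracField.tofrac {poly Fq} \o polyC))%FUN.
have pL := rmorph_pchar e (card_finPcharP card_Fq p_prime).
by rewrite -(dvdn_pcharf pL).
Qed.
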